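(* Let $\kappa=(\kappa_1,\kappa_2)\in\mathbb{R}^2$ and $$\Omega^\kappa:=\{x=(x_1,x_2,x_3)\in\mathbb{R}^3 : x_1>\kappa_1x_3,\ x_2>\kappa_2x_3,\ x_3\in(0,1)\}.$$ Assume that $u\in H^1(\Omega^\kappa)$ satisfies $$-\Delta u=\lambda u\ \text{ in }\Omega^\kappa,\qquad u=0\ \text{ on }\partial\Omega^\kappa$$ for some $\lambda\in\mathbb{C}$. Then $u\equiv0$ in $\Omega^\kappa$.
   Context: $H^1(\Omega^\kappa)$ is the usual Sobolev space; the equation is understood in the sense of distributions and the boundary condition in the sense of traces. *)

(* Defs.v *)
From HB Require Import structures.
From mathcomp Require Import all_boot all_order all_algebra.
From mathcomp Require Import complex.
From mathcomp Require Import all_classical all_reals all_analysis measurable_realfun.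
Set Implicit Arguments.
Unset Strict Implicit.
Unset Printing Implicit Defensive.
Import Order.TTheory GRing.Theory Num.Theory.
Import numFieldNormedType.Exports.
Local Open Scope classical_set_scope.
Local Open Scope complex_scope.
Local Open Scope ring_scope.

(* The point (x1, x2, x3) of R^3 is ((x1, x2), x3). *)
Notation space R := (R * R * R)%type.

(* The same types, with the Borel structure for which lebesgue_measure is
   defined; R itself carries a convertible structure with another display. *)
Notation mplane R := (measurableTypeR R * measurableTypeR R)%type.
Notation mspace R := (mplane R * measurableTypeR R)%type.

Section lebesgue.
Variable R : realType.

Definition leb2 := (@lebesgue_measure R \x @lebesgue_measure R)%E.
HB.instance Definition _ := Measure.on leb2.

Lemma sigma_finite_leb2 : sigma_finite setT leb2.
Proof.
have /sigma_finiteP[F [TF ndF Foo]] := sigma_finiteT (@lebesgue_measure R).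
exists (fun n => F n `*` F n).
  rewrite -setXTT {1 2}TF predeqE => -[x y]; split.
    move=> [/= [n _ Fnx] [k _ Fky]]; exists (maxn n k) => //; split.
    - by move: x Fnx; exact/subsetPset/ndF/leq_maxl.
    - by move: y Fky; exact/subsetPset/ndF/leq_maxr.
  by move=> [n _ []/= ? ?]; split; exists n.
move=> k; have [mF Fk] := Foo k; split; first exact: measurableX.
by rewrite /leb2 product_measure1E// lte_mul_pinfty// ge0_fin_numE.
Qed.
HB.instance Definition _ :=
  Measure_isSigmaFinite.Build _ _ _ leb2 sigma_finite_leb2.

Definition leb3 := (leb2 \x @lebesgue_measure R)%E.
HB.instance Definition _ := Measure.on leb3.

End lebesgue.
Arguments leb2 {R}.
Arguments leb3 {R}.

Section smooth_functions.
Variable R : realType.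
Implicit Types (O : set (space R)) (h : space R -> R) (f : space R -> R[i]).

Definition dir (i : 'I_3) : space R :=
  ((i == 0 :> nat)%N%:R, (i == 1 :> nat)%N%:R, (i == 2 :> nat)%N%:R).

Definition rpartial (i : 'I_3) h : space R -> R := fun x => 'D_(dir i) h x.

Fixpoint continuously_differentiable (n : nat) h : Prop :=
  continuous h /\
  if n is m.+1 then forall i,
    (forall x, derivable h x (dir i)) /\
    continuously_differentiable m (rpartial i h)
  else True.

Definition re f : space R -> R := fun x => complex.Re (f x).
Definition im f : space R -> R := fun x => complex.Im (f x).

Definition smooth f : Prop := forall n,
  continuously_differentiable n (re f) /\ continuously_differentiable n (im f).

Definition partial (i : 'I_3) f : space R -> R[i] :=
  fun x => rpartial i (re f) x +i* rpartial i (im f) x.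

Definition laplacian f : space R -> R[i] :=
  fun x => \sum_(i < 3) partial i (partial i f) x.

Definition supp f : set (space R) := closure [set x | f x != 0].

Definition test_function O f : Prop :=
  [/\ smooth f, compact (supp f) & supp f `<=` O].

End smooth_functions.

Section sobolev.
Variable R : realType.
Implicit Types (O D : set (space R)) (f g u : space R -> R[i]).

Definition cintegral D f : R[i] :=
  Rintegral leb3 D (re f) +i* Rintegral leb3 D (im f).

Definition sqmod (z : R[i]) : R := complex.Re z ^+ 2 + complex.Im z ^+ 2.

Definition sq_dist (mu : {measure set (mspace R) -> \bar R}) D f g : \bar R :=
  (\int[mu]_(x in D) (sqmod (f x - g x))%:E)%E.

Definition L2 (mu : {measure set (mspace R) -> \bar R}) D f : Prop :=
  [/\ measurable_fun D (re f : mspace R -> R),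
      measurable_fun D (im f : mspace R -> R) &
      (sq_dist mu D f (fun=> 0%R) < +oo)%E].

Definition weak_partial O (i : 'I_3) u g : Prop :=
  forall phi, test_function O phi ->
    cintegral O (fun x => u x * partial i phi x) =
    - cintegral O (fun x => g x * phi x).

Definition weak_gradient O u (w : 'I_3 -> space R -> R[i]) : Prop :=
  forall i, L2 leb3 O (w i) /\ weak_partial O i u (w i).

Definition H1 O u : Prop := L2 leb3 O u /\ exists w, weak_gradient O u w.

(* - Delta u = lambda u as distributions on O. *)
Definition helmholtz O (lambda : R[i]) u : Prop :=
  forall phi, test_function O phi ->
    - cintegral O (fun x => u x * laplacian phi x) =
    lambda * cintegral O (fun x => u x * phi x).

Definition boundary O : set (space R) := closure O `\` interior O.

(* g is the trace of u in H1 O, where sigma induces the surface measure on the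
   boundary of O: the trace operator H1 O -> L2 (boundary O) is the continuous
   extension of the restriction of smooth compactly supported functions on
   R^3. *)
Definition has_trace O (sigma : {measure set (mspace R) -> \bar R}) u g : Prop :=
  L2 sigma (boundary O) g /\
  exists w, weak_gradient O u w /\
  exists phi : nat -> space R -> R[i],
    [/\ forall n, test_function setT (phi n),
        sq_dist leb3 O (phi n) u @[n --> \oo] --> 0%E,
        forall i, sq_dist leb3 O (partial i (phi n)) (w i) @[n --> \oo] --> 0%E
      & sq_dist sigma (boundary O) (phi n) g @[n --> \oo] --> 0%E].

End sobolev.

Section layer.
Variables (R : realType) (kappa1 kappa2 : R).

Definition layer : set (space R) :=
  [set x | [/\ x.1.1 > kappa1 * x.2, x.1.2 > kappa2 * x.2 & 0 < x.2 < 1]].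

(* Parametrizations of the four planes x1 = kappa1 x3, x2 = kappa2 x3, x3 = 0
   and x3 = 1 containing the faces of the layer. *)
Definition plane1 (p : mplane R) : mspace R := (kappa1 * p.2, p.1, p.2).
Definition plane2 (p : mplane R) : mspace R := (p.1, kappa2 * p.2, p.2).
Definition plane3 (p : mplane R) : mspace R := (p.1, p.2, 0).
Definition plane4 (p : mplane R) : mspace R := (p.1, p.2, 1).

(* The sum of the area measures of the four planes, the factors
   sqrt (1 + kappa_j ^ 2) being the Jacobians of plane1 and plane2. Each plane
   meets the boundary of the layer exactly in one face, and two planes meet in
   at most a line, so on the boundary this is the surface measure. *)
Definition planes_area (A : set (mspace R)) : \bar R :=
  ((Num.sqrt (1 + kappa1 ^+ 2))%:E * pushforward leb2 plane1 A +
   (Num.sqrt (1 + kappa2 ^+ 2))%:E * pushforward leb2 plane2 A +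
   pushforward leb2 plane3 A + pushforward leb2 plane4 A)%E.

Lemma measurable_plane1 : measurable_fun setT plane1.
Proof.
apply: measurable_fun_pair => //; apply: measurable_fun_pair => //.
exact: (measurableT_comp (mulrl_measurable kappa1) measurable_snd).
Qed.

Lemma measurable_plane2 : measurable_fun setT plane2.
Proof.
apply: measurable_fun_pair => //; apply: measurable_fun_pair => //.
exact: (measurableT_comp (mulrl_measurable kappa2) measurable_snd).
Qed.

Lemma measurable_plane3 : measurable_fun setT plane3.
Proof. by apply: measurable_fun_pair => //; apply: measurable_fun_pair. Qed.

Lemma measurable_plane4 : measurable_fun setT plane4.
Proof. by apply: measurable_fun_pair => //; apply: measurable_fun_pair. Qed.

Lemma planes_area_measure :
  exists m : {measure set (mspace R) -> \bar R}, planes_area = m.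
Proof.
have pf P : measurable_fun setT P ->
    exists m : {measure set (mspace R) -> \bar R}, pushforward leb2 P = m.
  move=> mP.
  by unshelve eexists [the {measure set _ -> \bar R} of pushforward leb2 P].
have [m1 e1] := pf _ measurable_plane1.
have [m2 e2] := pf _ measurable_plane2.
have [m3 e3] := pf _ measurable_plane3.
have [m4 e4] := pf _ measurable_plane4.
pose s1 : {measure set (mspace R) -> \bar R} :=
  mscale (NngNum (sqrtr_ge0 (1 + kappa1 ^+ 2))) m1.
pose s2 : {measure set (mspace R) -> \bar R} :=
  mscale (NngNum (sqrtr_ge0 (1 + kappa2 ^+ 2))) m2.
pose m12 := measure_add s1 s2.
pose m123 := measure_add m12 m3.
exists (measure_add m123 m4); apply/funext => A.
rewrite /planes_area e1 e2 e3 e4.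
apply: (etrans _ (esym (measure_addE m123 m4 A))); congr (_ + _)%E.
apply: (etrans _ (esym (measure_addE m12 m3 A))); congr (_ + _)%E.
exact: (esym (measure_addE s1 s2 A)).
Qed.

Let planes_area0 : planes_area set0 = 0%E.
Proof. by have [m ->] := planes_area_measure; exact: measure0. Qed.

Let planes_area_ge0 A : (0 <= planes_area A)%E.
Proof. by have [m ->] := planes_area_measure. Qed.

Let planes_area_sigma_additive : semi_sigma_additive planes_area.
Proof.
by have [m ->] := planes_area_measure; exact: measure_semi_sigma_additive.
Qed.

HB.instance Definition _ := isMeasure.Build _ _ _ planes_area
  planes_area0 planes_area_ge0 planes_area_sigma_additive.

End layer.

(* Main.v *)
From HB Require Import structures.
From mathcomp Require Import all_boot all_order all_algebra complex.
From mathcomp Require Import ring lra.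
From mathcomp Require Import all_classical all_reals all_analysis measurable_realfun.
Require Import Defs.
Set Implicit Arguments.
Unset Strict Implicit.
Unset Printing Implicit Defensive.
Import Order.TTheory GRing.Theory Num.Theory.
Import numFieldNormedType.Exports.
Local Open Scope classical_set_scope.
Local Open Scope ring_scope.

(** The translations $T_t f = f(\cdot - t e_1)$ with $t > 0$ map functions supported
    in the layer to functions supported in the layer ([layer_translate]), and they
    preserve integrals. Let $f$ be a real solution in $H^1_0$ for the eigenvalue
    $\mu$, and $B(f, g) = \int \nabla f \cdot \nabla g - \mu \int f g$. For $j \le k$
    we have $B(T^j f, T^k f) = B(f, T^{k-j} f) = 0$, because $T^{k-j} f$ is a
    legitimate test function for the equation of $f$. Hence all the differences
    $f_n = (1 - T)^n f$ satisfy $B(f_n, f_n) = 0$ ([orth_iter]), that is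
    $\|\nabla f_n\|^2 = \mu \|f_n\|^2$. As
    $\|f_{n+1}\| = \|f_n - T f_n\| \le C t \|\partial_1 f_n\|$, a small $t$ makes
    $f_n$ tend to zero ([iter_dif_le]). On the other hand, if $f$ vanishes for
    $x_1 < c$ then $f_n = f$ for $x_1 < c + t$. So $f$ vanishes there as well, and
    by induction everywhere ([slab_eq0], [solution_eq0]); the induction starts
    because $x_1 > - |\kappa_1|$ in the layer.

    For a complex eigenvalue $\lambda$, testing the equation of $\Re u$ with $\Im u$
    and conversely gives $\Im \lambda \, \|u\|^2 = 0$. So either $u = 0$ or $\lambda$ is
    real and the argument applies to both parts ([solution_parts_eq0]).

    It remains to see that a zero trace puts $u$ in the closure of the test functions
    of the layer ([approximable_layer]). Let $\phi$ be a smooth approximation of $u$ with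
    small boundary values, $\ell$ the affine function that defines a face and $k$ a
    direction with $\partial_k \ell = 1$ such that the strip $\{\ell < e\}$ is the
    union of the segments in the direction $k$ issued from the face. The fundamental
    theorem of calculus along them bounds $\int_{\ell < e} \phi^2$ by
    $2 e \int_{\ell = 0} \phi^2 + 2 e^2 \int_{\ell < e} (\partial_k \phi)^2$
    ([strip_le_area]). In the limit $\int_{\ell < e} u^2$ is at most $8 e^2$ times an
    integral over the strip that tends to zero with $e$, which is what is needed for
    the multiplication by a cutoff $\chi(\ell / e)$ to cost arbitrarily little in
    $H^1$ ([approximable_off_face]). This is done for the four faces in turn. *)

(** * Integration along lines *)

Section lebesgue_space.
Variable R : realType.
Local Notation leb := (@lebesgue_measure R).
Local Open Scope ereal_scope.

Lemma measurable_shift (c : R) :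
  measurable_fun setT ((fun x : R => x + c)%R : measurableTypeR R -> measurableTypeR R).
Proof.
by apply: continuous_measurable_fun => x; apply: cvgD; [exact: cvg_id|exact: cvg_cst].
Qed.

Lemma ge0_integral_leb_shift (c : R) (F : measurableTypeR R -> \bar R) :
  measurable_fun setT F -> (forall x, 0 <= F x) ->
  \int[leb]_x F (x + c)%R = \int[leb]_x F x.
Proof.
move=> mF F0.
pose tau : measurableTypeR R -> measurableTypeR R := fun x : R => (x + c)%R.
have H := @ge0_integral_pushforward _ _ _ _ R
  tau (measurable_shift c) leb setT F measurableT mF (fun x _ => F0 x).
rewrite preimage_setT in H; rewrite -[LHS]H.
refine (eq_measure_integral _ _) => /= A mA _.
have : leb A = pushforward leb tau A; last by [].
apply: lebesgue_measure_unique => // [|? _ [[a b] _ <-]]; first exact: measurable_shift.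
rewrite /= /pushforward (_ : _ @^-1` _ = `]a - c, b - c]%classic)%R; last first.
  by apply/seteqP; split => x /=; rewrite !in_itv/= ltrBlDr lerBrDr.
rewrite /= !lebesgue_measure_itv/= !lte_fin ltrD2r.
by congr (if _ then _ else _); rewrite -!EFinB; congr (_%:E); ring.
Unshelve. all: exact: measurable_shift.
Qed.

Lemma ge0_integral_leb_opp (c : R) (F : measurableTypeR R -> \bar R) :
  measurable_fun setT F -> (forall x, 0 <= F x) ->
  \int[leb]_x F (c - x)%R = \int[leb]_x F x.
Proof.
move=> mF F0.
pose opp : measurableTypeR R -> measurableTypeR R := fun x : R => (- x)%R.
have mo : measurable_fun setT opp.
  by apply: continuous_measurable_fun; exact: opp_continuous.
pose G x := F (x + c)%R.
have mG : measurable_fun setT G by exact: (measurableT_comp mF (measurable_shift c)).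
have H := @ge0_integral_pushforward _ _ _ _ R
  opp mo leb setT G measurableT mG (fun x _ => F0 _).
rewrite preimage_setT in H.
rewrite -[RHS](ge0_integral_leb_shift c mF F0).
transitivity (\int[leb]_x (G \o opp) x); first by apply: eq_integral => x _; rewrite /G/= addrC.
rewrite -[LHS]H; refine (eq_measure_integral _ _) => /= A mA _.
exact: lebesgue_measureN.
Unshelve. all: exact: mo.
Qed.

Lemma ge0_integral_leb2 (F : mplane R -> \bar R) :
  measurable_fun setT F -> (forall x, 0 <= F x) ->
  \int[leb2]_x F x = \int[leb]_y \int[leb]_x F (x, y).
Proof. by move=> mF F0; exact: (fubini_tonelli2 (m1 := leb) (m2 := leb) F mF F0). Qed.

Lemma ge0_integral_leb3 (F : mspace R -> \bar R) :
  measurable_fun setT F -> (forall x, 0 <= F x) ->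
  \int[leb3]_x F x = \int[leb]_z \int[leb]_y \int[leb]_x F (x, y, z).
Proof.
move=> mF F0; rewrite [LHS]fubini_tonelli2//; apply: eq_integral => z _.
rewrite /fubini_G.
rewrite [LHS]fubini_tonelli2//; exact: measurableT_comp.
Qed.

Lemma ge0_integral_leb3_yx (F : mspace R -> \bar R) :
  measurable_fun setT F -> (forall x, 0 <= F x) ->
  \int[leb3]_x F x = \int[leb]_z \int[leb]_x \int[leb]_y F (x, y, z).
Proof.
move=> mF F0; rewrite [LHS]fubini_tonelli2//; apply: eq_integral => z _.
rewrite /fubini_G.
rewrite [LHS]fubini_tonelli1//; exact: measurableT_comp.
Qed.

Lemma measurable_affine d (T : measurableType d) (c : R) (f g : T -> measurableTypeR R) :
  measurable_fun setT f -> measurable_fun setT g ->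
  measurable_fun setT ((fun x => f x + c * g x)%R : T -> measurableTypeR R).
Proof.
by move=> mf mg; apply: measurable_funD => //; exact: measurable_funM.
Qed.

Section lines.
Variables (k1 k2 : R) (F : mspace R -> \bar R).
Hypotheses (mF : measurable_fun setT F) (F0 : forall x, 0 <= F x).

(** In each of the four coordinate systems below, [p] parametrizes the plane of a
    face and [s] is the abscissa along the lines that cross it. The change of
    variables is a composition of translations in one coordinate at a time, and of
    a reflection for the last one, so it preserves the volume. *)
Lemma ge0_integral_leb3_line1 :
  \int[leb3]_x F x = \int[leb2]_p \int[leb]_s F (s + k1 * p.2, p.1, p.2)%R.
Proof.
have mG : measurable_fun setT (fun q : mplane R * measurableTypeR R =>
    F (q.2 + k1 * q.1.2, q.1.1, q.1.2)%R).
  apply: (measurableT_comp mF).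
  apply: measurable_fun_pair; first apply: measurable_fun_pair.
  - apply: measurable_affine => //; exact: measurableT_comp.
  - exact: measurableT_comp.
  - exact: measurableT_comp.
rewrite ge0_integral_leb3//.
rewrite [RHS](ge0_integral_leb2 (F := fun p => \int[leb]_s F (s + k1 * p.2, p.1, p.2)%R)); first last.
- by move=> p; apply: integral_ge0.
- exact: (measurable_fun_fubini_tonelli_F (m2 := leb) _ mG (fun _ => F0 _)).
apply: eq_integral => z _; apply: eq_integral => y _ /=.
rewrite (ge0_integral_leb_shift (k1 * z) (F := fun x => F (x, y, z)))//.
apply: (measurableT_comp mF).
by apply: measurable_fun_pair => //; apply: measurable_fun_pair.
Qed.

Lemma ge0_integral_leb3_line2 :
  \int[leb3]_x F x = \int[leb2]_p \int[leb]_s F (p.1, s + k2 * p.2, p.2)%R.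
Proof.
have mG : measurable_fun setT (fun q : mplane R * measurableTypeR R =>
    F (q.1.1, q.2 + k2 * q.1.2, q.1.2)%R).
  apply: (measurableT_comp mF).
  apply: measurable_fun_pair; first apply: measurable_fun_pair.
  - exact: measurableT_comp.
  - apply: measurable_affine => //; exact: measurableT_comp.
  - exact: measurableT_comp.
rewrite ge0_integral_leb3_yx//.
rewrite [RHS](ge0_integral_leb2 (F := fun p => \int[leb]_s F (p.1, s + k2 * p.2, p.2)%R)); first last.
- by move=> p; apply: integral_ge0.
- exact: (measurable_fun_fubini_tonelli_F (m2 := leb) _ mG (fun _ => F0 _)).
apply: eq_integral => z _; apply: eq_integral => y _ /=.
rewrite (ge0_integral_leb_shift (k2 * z) (F := fun x => F (y, x, z)))//.
apply: (measurableT_comp mF).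
by apply: measurable_fun_pair => //; apply: measurable_fun_pair.
Qed.

(** The lines through a horizontal face have direction $(k_1, k_2, 1)$ because
    this direction keeps $x_1 - k_1 x_3$ and $x_2 - k_2 x_3$ fixed. *)
Lemma ge0_integral_leb3_line3 :
  \int[leb3]_x F x = \int[leb2]_p \int[leb]_s F (p.1 + k1 * s, p.2 + k2 * s, s)%R.
Proof.
have mG : measurable_fun setT (fun q : mplane R * measurableTypeR R =>
    F (q.1.1 + k1 * q.2, q.1.2 + k2 * q.2, q.2)%R).
  apply: (measurableT_comp mF).
  apply: measurable_fun_pair => //; apply: measurable_fun_pair.
  - apply: measurable_affine => //; exact: measurableT_comp.
  - apply: measurable_affine => //; exact: measurableT_comp.
rewrite ge0_integral_leb3// [RHS](fubini_tonelli (m1 := leb2) (m2 := leb) _ mG (fun _ => F0 _))/=.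
apply: eq_integral => z _.
have mFz : measurable_fun setT (fun p : mplane R => F (p.1 + k1 * z, p.2 + k2 * z, z)%R).
  apply: (measurableT_comp mF).
  apply: measurable_fun_pair => //; apply: measurable_fun_pair.
  - apply: measurable_affine => //; exact: measurableT_comp.
  - apply: measurable_affine => //; exact: measurableT_comp.
have mGz : measurable_fun setT (fun y => \int[leb]_x F (x, y, z)).
  apply: (measurable_fun_fubini_tonelli_G (m1 := leb) (fun p : mplane R => F (p, z))) => //.
  exact: (measurableT_comp mF).
apply: etrans (esym (ge0_integral_leb2 mFz (fun _ => F0 _))).
apply: etrans (esym (ge0_integral_leb_shift (k2 * z) mGz _)) _.
  by move=> y; apply: integral_ge0.
apply: eq_integral => y _ /=.
rewrite (ge0_integral_leb_shift (k1 * z) (F := fun x => F (x, y + k2 * z, z)%R))//.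
apply: (measurableT_comp mF).
by apply: measurable_fun_pair => //; apply: measurable_fun_pair.
Qed.

End lines.

Section reflection.
Variables (k1 k2 : R) (F : mspace R -> \bar R).
Hypotheses (mF : measurable_fun setT F) (F0 : forall x, 0 <= F x).

Lemma ge0_integral_leb3_line4 :
  \int[leb3]_x F x =
  \int[leb2]_p \int[leb]_s F (p.1 + k1 * s, p.2 + k2 * s, 1 - s)%R.
Proof.
have mG : measurable_fun setT (fun x : mspace R => F (x.1, 1 - x.2)%R).
  apply: (measurableT_comp mF).
  apply: measurable_fun_pair => //; apply: measurable_funB => //.
rewrite -(ge0_integral_leb3_line3 k1 k2 mG (fun _ => F0 _)).
rewrite (ge0_integral_leb3 mG (fun _ => F0 _)) (ge0_integral_leb3 mF F0).
rewrite -(ge0_integral_leb_opp 1%R (F := fun z => \int[leb]_y \int[leb]_x F (x, y, z)))//.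
- have mH : measurable_fun setT (fun z : measurableTypeR R =>
    \int[leb2]_p F (p, z)) by exact: (measurable_fun_fubini_tonelli_G (m1 := leb2) F).
  apply: (eq_measurable_fun _ _ mH) => z _.
  rewrite [LHS]fubini_tonelli2//; exact: measurableT_comp.
- by move=> z; do 2 (apply: integral_ge0 => ? _).
Qed.

Lemma ge0_integral_leb3_shift (t : R) :
  \int[leb3]_x F (x.1.1 + t, x.1.2, x.2)%R = \int[leb3]_x F x.
Proof.
have mG : measurable_fun setT (fun x : mspace R => F (x.1.1 + t, x.1.2, x.2)%R).
  apply: (measurableT_comp mF).
  apply: measurable_fun_pair => //; apply: measurable_fun_pair.
  - apply: (measurableT_comp (measurable_shift t)); exact: measurableT_comp.
  - exact: measurableT_comp.
rewrite (ge0_integral_leb3 mG (fun _ => F0 _)) (ge0_integral_leb3 mF F0).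
apply: eq_integral => z _; apply: eq_integral => y _ /=.
rewrite (ge0_integral_leb_shift t (F := fun x => F (x, y, z)))//.
apply: (measurableT_comp mF).
by apply: measurable_fun_pair => //; apply: measurable_fun_pair.
Qed.

End reflection.

End lebesgue_space.

(** * Borel sets of the product topology *)

Section open_measurable_space.
Variable R : realType.

(** An open set is the countable union of the boxes with rational endpoints that
    it contains. *)
Lemma open_measurable_space (U : set (space R)) :
  open U -> measurable (U : set (mspace R)).
Proof.
move=> oU.
pose box (q : (rat * rat) * (rat * rat) * (rat * rat)) : set (mspace R) :=
  (`]ratr q.1.1.1, ratr q.1.1.2[ `*` `]ratr q.1.2.1, ratr q.1.2.2[)
    `*` `]ratr q.2.1, ratr q.2.2[.
pose F q := [set x | box q x /\ box q `<=` (U : set (mspace R))].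
have -> : (U : set (mspace R)) = \bigcup_q F q.
  apply/seteqP; split=> [x Ux|x [q _ [Bx BU]]]; last exact: BU.
  have : nbhs (x : space R) U by exact: open_nbhs_nbhs.
  move=> /nbhs_ballP[e /= e0 eU].
  have rr (y : R) : exists q : rat * rat,
      [/\ y - e < ratr q.1, ratr q.1 < y, y < ratr q.2 & ratr q.2 < y + e].
    have [a] := @rat_in_itvoo R (y - e) y ltac:(by rewrite ltrBlDr ltrDl).
    have [b] := @rat_in_itvoo R y (y + e) ltac:(by rewrite ltrDl).
    rewrite !in_itv/= => /andP[b1 b2] /andP[a1 a2].
    by exists (a, b).
  have [q1 [q11 q12 q13 q14]] := rr x.1.1.
  have [q2 [q21 q22 q23 q24]] := rr x.1.2.
  have [q3 [q31 q32 q33 q34]] := rr x.2.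
  exists (q1, q2, q3) => //; split.
    by split; [split|] => /=; rewrite in_itv/=; apply/andP; split.
  move=> [[y1 y2] y3] [[/=]]; rewrite !in_itv/=.
  move=> /andP[a1 b1] /andP[a2 b2] /andP[a3 b3].
  apply: eU; split; [split|]; rewrite /= /ball/= ltr_distlC.
  - by rewrite (lt_trans q11 a1) (lt_trans b1 q14).
  - by rewrite (lt_trans q21 a2) (lt_trans b2 q24).
  - by rewrite (lt_trans q31 a3) (lt_trans b3 q34).
apply: countable_bigcupT_measurable => [|q]; first exact: countableP.
have [BU|BU] := pselect (box q `<=` (U : set (mspace R))).
  rewrite (_ : F q = box q); last by apply/seteqP; split=> [x []|x].
  by apply: measurableX; [apply: measurableX|]; exact: measurable_itv.
by rewrite (_ : F q = set0)//; apply/seteqP; split=> [x []|].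
Qed.

Lemma continuous_measurable_space (f : space R -> R) :
  continuous f -> measurable_fun setT (f : mspace R -> R).
Proof.
move=> /continuousP cf; apply: (measurability _ (RGenOpens.measurableE R)).
move=> _ [_ [a [b ->] <-]]; rewrite setTI.
by apply: open_measurable_space; apply: cf; exact: interval_open.
Qed.

End open_measurable_space.

(** * Square integrable functions *)

Section square_integrable.
Context d (T : measurableType d) (R : realType).
Variable mu : {measure set T -> \bar R}.
Implicit Types f g h : T -> R.

Definition sqi f := measurable_fun setT f /\
  (\int[mu]_x (f x ^+ 2)%:E < +oo)%E.

Definition ip f g := \int[mu]_(x in setT) (f x * g x).

Lemma sqi_integrable f : sqi f -> mu.-integrable setT (EFin \o (fun x => f x ^+ 2)).
Proof.
move=> [mf fi]; apply/integrableP; split.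
  by apply/measurable_EFinP; exact: measurable_funX.
by under eq_integral do rewrite /= ger0_norm ?sqr_ge0//.
Qed.

Lemma integrable_mul f g : sqi f -> sqi g ->
  mu.-integrable setT (EFin \o (fun x => f x * g x)).
Proof.
move=> sf sg.
apply: (@le_integrable _ _ _ mu setT measurableT _
    (EFin \o (fun x => f x ^+ 2 + g x ^+ 2))).
- by apply/measurable_EFinP; apply: measurable_funM; [case: sf|case: sg].
- move=> x _ /=; rewrite lee_fin [leRHS]ger0_norm ?addr_ge0 ?sqr_ge0//.
  rewrite normrM -(real_normK (num_real (f x))) -(real_normK (num_real (g x))).
  have : 0 <= (`|f x| - `|g x|) ^+ 2 by exact: sqr_ge0.
  have : 0 <= `|f x| * `|g x| by rewrite mulr_ge0.
  nra.
- exact: (integrableD measurableT (sqi_integrable sf) (sqi_integrable sg)).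
Qed.

Lemma sqiD f g : sqi f -> sqi g -> sqi (fun x => f x + g x).
Proof.
move=> sf sg; have [mf _] := sf; have [mg _] := sg; split.
  exact: measurable_funD.
have H : mu.-integrable setT (EFin \o (fun x => f x ^+ 2 + g x ^+ 2 + (f x * g x + f x * g x))).
  exact: (integrableD measurableT
    (integrableD measurableT (sqi_integrable sf) (sqi_integrable sg))
    (integrableD measurableT (integrable_mul sf sg) (integrable_mul sf sg))).
have [_ /=] := integrableP _ _ _ H; apply: le_lt_trans.
rewrite le_eqVlt; apply/orP; left; apply/eqP; apply: eq_integral => x _ /=; congr (_%:E).
rewrite ger0_norm; first ring.
rewrite (_ : _ + _ = (f x + g x) ^+ 2); last ring.
exact: sqr_ge0.
Qed.

Lemma sqiM (c : R) f h : measurable_fun setT h -> (forall x, `|h x| <= c) ->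
  sqi f -> sqi (fun x => h x * f x).
Proof.
move=> mh hc sf; have [mf fi] := sf; split; first exact: measurable_funM.
have c0 : 0 <= c ^+ 2 by exact: sqr_ge0.
apply: (@le_lt_trans _ _ (\int[mu]_x ((c ^+ 2)%:E * (f x ^+ 2)%:E))%E).
  apply: ge0_le_integral => //.
  - by move=> x _; rewrite lee_fin sqr_ge0.
  - by apply/measurable_EFinP; apply: measurable_funX; exact: measurable_funM.
  - apply/measurable_EFinP; apply: measurable_funM => //; exact: measurable_funX.
  - move=> x _; rewrite lee_fin exprMn ler_wpM2r ?sqr_ge0//.
    by rewrite -(real_normK (num_real (h x))) lerXn2r ?nnegrE ?(le_trans _ (hc x)).
rewrite ge0_integralZl//; last 2 first.
  by apply/measurable_EFinP; exact: measurable_funX.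
  by move=> x _; rewrite lee_fin sqr_ge0.
rewrite lte_mul_pinfty// integral_ge0// => x _; by rewrite lee_fin sqr_ge0.
Qed.

Lemma sqiZ (c : R) f : sqi f -> sqi (fun x => c * f x).
Proof. by move=> sf; apply: (@sqiM `|c|). Qed.

Lemma sqiB f g : sqi f -> sqi g -> sqi (fun x => f x - g x).
Proof.
move=> sf sg; have := sqiD sf (sqiZ (-1) sg); congr (sqi _).
by apply/funext => x; rewrite mulN1r.
Qed.

Lemma ipC f g : ip f g = ip g f.
Proof. by apply: eq_Rintegral => x _; rewrite mulrC. Qed.

Lemma ipDl f g h : sqi f -> sqi g -> sqi h ->
  ip (fun x => f x + g x) h = ip f h + ip g h.
Proof.
move=> sf sg sh; rewrite /ip -RintegralD//; try exact: integrable_mul.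
by apply: eq_Rintegral => x _; rewrite mulrDl.
Qed.

Lemma ipBl f g h : sqi f -> sqi g -> sqi h ->
  ip (fun x => f x - g x) h = ip f h - ip g h.
Proof.
move=> sf sg sh; rewrite /ip -RintegralB//; try exact: integrable_mul.
by apply: eq_Rintegral => x _; rewrite mulrBl.
Qed.

Lemma ipZl (c : R) f h : sqi f -> sqi h ->
  ip (fun x => c * f x) h = c * ip f h.
Proof.
move=> sf sh; rewrite /ip -RintegralZl//; last exact: integrable_mul.
by apply: eq_Rintegral => x _; rewrite mulrA.
Qed.

Lemma ip_ge0 f : 0 <= ip f f.
Proof. by apply: Rintegral_ge0 => x _; rewrite -expr2 sqr_ge0. Qed.

Lemma ip_sqr f : sqi f -> (\int[mu]_x (f x ^+ 2)%:E)%E = (ip f f)%:E.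
Proof.
move=> sf; rewrite /ip /Rintegral fineK; last first.
  exact/integrable_fin_num/integrable_mul.
by apply: eq_integral => x _.
Qed.

Lemma le_ip f g : sqi f -> sqi g -> (forall x, f x ^+ 2 <= g x ^+ 2) ->
  ip f f <= ip g g.
Proof.
move=> sf sg fg; apply: le_Rintegral => //; try exact: integrable_mul.
by move=> x _; rewrite -!expr2.
Qed.

Lemma ip_quad (t : R) f g : sqi f -> sqi g ->
  ip (fun x => f x - t * g x) (fun x => f x - t * g x) =
  ip f f - (t * ip f g) *+ 2 + t ^+ 2 * ip g g.
Proof.
move=> sf sg.
have stg := sqiZ t sg.
have sh := sqiB sf stg.
rewrite ipBl// (ipC f) (ipC (fun x => t * g x)) !ipBl// !ipZl// (ipC f (fun x => t * g x)) ipZl//.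
rewrite (ipC g (fun x => t * g x)) ipZl// (ipC g f); ring.
Qed.

Lemma ip_cauchy f g : sqi f -> sqi g -> ip f g ^+ 2 <= ip f f * ip g g.
Proof.
move=> sf sg.
have q t : 0 <= ip f f - (t * ip f g) *+ 2 + t ^+ 2 * ip g g.
  by rewrite -ip_quad//; exact: ip_ge0.
have gg := ip_ge0 g; have ff := ip_ge0 f.
have [g0|gn0] := eqVneq (ip g g) 0.
  rewrite g0 mulr0; have [fg0|fgn0] := eqVneq (ip f g) 0; first by rewrite fg0 expr0n.
  have := q ((ip f f + 1) / (ip f g *+ 2)).
  rewrite g0 (_ : _ + _ = - 1); first by rewrite ler0N1.
  by field.
have gp : 0 < ip g g by rewrite lt_neqAle eq_sym gn0.
have := q (ip f g / ip g g).
rewrite (_ : _ + _ = ip f f - ip f g ^+ 2 / ip g g); last by field.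
by rewrite subr_ge0 ler_pdivrMr.
Qed.

Lemma ipD_le f g : sqi f -> sqi g ->
  ip (fun x => f x + g x) (fun x => f x + g x) <= ip f f *+ 2 + ip g g *+ 2.
Proof.
move=> sf sg.
have e1 := ip_quad (-1) sf sg; have e2 := ip_quad 1 sf sg.
have p2 := ip_ge0 (fun x => f x - 1 * g x).
rewrite (_ : (fun x => f x + g x) = (fun x => f x - -1 * g x)); last first.
  by apply/funext => x; rewrite mulN1r opprK.
by rewrite e1; move: p2; rewrite e2; lra.
Qed.

Lemma ipB_le f g : sqi f -> sqi g ->
  ip (fun x => f x - g x) (fun x => f x - g x) <= ip f f *+ 2 + ip g g *+ 2.
Proof.
move=> sf sg.
have e1 := ip_quad (-1) sf sg; have e2 := ip_quad 1 sf sg.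
have p2 := ip_ge0 (fun x => f x - (-1) * g x).
rewrite (_ : (fun x => f x - g x) = (fun x => f x - 1 * g x)); last first.
  by apply/funext => x; rewrite mul1r.
by rewrite e2; move: p2; rewrite e1; lra.
Qed.

Lemma ip_ae0 f : sqi f -> ip f f = 0 -> {ae mu, forall x, f x = 0}.
Proof.
move=> sf f0; have [mf _] := sf.
have := ip_sqr sf; rewrite f0.
move=> i0.
have : (\int[mu]_x `|(f x ^+ 2)%:E|)%E = 0%E.
  by apply: etrans i0; apply: eq_integral => x _; rewrite gee0_abs// lee_fin sqr_ge0.
move/ae_eq_integral_abs => /(_ measurableT) H.
have /H : measurable_fun setT (fun x => (f x ^+ 2)%:E).
  by apply/measurable_EFinP; exact: measurable_funX.
apply: filterS => x /(_ I)/= /eqP.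
by rewrite eqe sqrf_eq0 => /eqP.
Qed.

End square_integrable.

(** * Derivatives along lines *)

Section derive_along_lines.
Variables (R : realType) (V : normedModType R).
Implicit Types (f g : V -> R) (x y v w : V).

Lemma is_derive_line f y v (s df : R) :
  is_derive (s *: v + y) v f df <-> is_derive s 1 (fun r : R => f (r *: v + y)) df.
Proof.
have E : (fun h : R => h^-1 *: ((f \o shift (s *: v + y)) (h *: v) - f (s *: v + y))) =
    (fun h : R => h^-1 *: (((fun r : R => f (r *: v + y)) \o shift s) (h *: 1) - f (s *: v + y))).
  by apply/funext => h /=; rewrite addrA -scalerDl [h *: 1]mulr1.
split=> -[dv <-]; split.
- by move: dv; rewrite /derivable E.
- by rewrite /derive E.
- by move: dv; rewrite /derivable E.
- by rewrite /derive E.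
Qed.

Lemma is_derive_line0 f x v (df : R) :
  is_derive x v f df <-> is_derive (0 : R) 1 (fun r : R => f (r *: v + x)) df.
Proof. by rewrite -is_derive_line scale0r add0r. Qed.

Lemma is_derive_translate f x v w (df : R) :
  is_derive (x + w) v f df <-> is_derive x v (fun y => f (y + w)) df.
Proof.
have E : (fun h : R => h^-1 *: ((f \o shift (x + w)) (h *: v) - f (x + w))) =
    (fun h : R => h^-1 *: (((fun y => f (y + w)) \o shift x) (h *: v) - f (x + w))).
  by apply/funext => h /=; rewrite addrA.
split=> -[dv <-]; split.
- by move: dv; rewrite /derivable E.
- by rewrite /derive E.
- by move: dv; rewrite /derivable E.
- by rewrite /derive E.
Qed.

Lemma is_derive_comp_line (F : R -> R) g x v (dF dg : R) :
  is_derive (g x) 1 F dF -> is_derive x v g dg ->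
  is_derive x v (fun y => F (g y)) (dF * dg).
Proof.
move=> dFx /is_derive_line0 dgx; apply/is_derive_line0.
apply: (@is_derive1_comp R F (fun r : R => g (r *: v + x))) => //=.
by rewrite scale0r add0r.
Qed.

Lemma is_deriveZdir f x v (c df : R) :
  is_derive x v f df -> is_derive x (c *: v) f (c * df).
Proof.
move=> /is_derive_line0 dfx; apply/is_derive_line0.
have -> : (fun r : R => f (r *: (c *: v) + x)) =
    (fun r : R => f (r *: v + x)) \o (fun r => c * r).
  by apply/funext => r /=; rewrite scalerA mulrC.
rewrite mulrC; apply: is_derive1_comp.
  by rewrite mulr0.
have -> : ( *%R c : R -> R) = c *: (id : R -> R) by apply/funext.
apply: is_derive_eq; by rewrite [LHS]mulr1.
Qed.

Lemma MVT_line f v (y : V) (h : R) : (forall z, derivable f z v) ->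
  exists2 t : R, 0 <= t <= 1 & f (h *: v + y) - f y = h * 'D_v f ((t * h) *: v + y).
Proof.
move=> dv.
have D (r : R) : is_derive r 1 (fun r : R => f (r *: (h *: v) + y))
    (h * 'D_v f (r *: (h *: v) + y)).
  by apply/is_derive_line; apply: is_deriveZdir; apply: derivableP.
have [|c] := @MVT_segment R (fun r : R => f (r *: (h *: v) + y))
    (fun r => h * 'D_v f (r *: (h *: v) + y)) 0 1 ler01 (fun r _ => D r).
  apply: continuous_subspaceT => r.
  by apply/differentiable_continuous/derivable1_diffP; case: (D r).
rewrite in_itv/= scale1r scale0r add0r subr0 mulr1 => c01 E.
by exists c => //; rewrite E scalerA.
Qed.

(** After the step along [w], the mean value theorem replaces the increment along
    [v] by a value of ['D_v f] near [x], which is close to ['D_v f x] by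
    continuity. *)
Lemma is_deriveDdir f x v w :
  (forall z, derivable f z v) -> {for x, continuous (fun z => 'D_v f z)} ->
  derivable f x w -> is_derive x (v + w) f ('D_v f x + 'D_w f x).
Proof.
move=> dv cv dw.
have H : (fun h : R => h^-1 *: ((f \o shift x) (h *: (v + w)) - f x)) @ 0^' -->
    'D_v f x + 'D_w f x; last first.
  by split; [exact: (cvgP _ H)|exact: (cvg_lim _ H)].
have -> : (fun h : R => h^-1 *: ((f \o shift x) (h *: (v + w)) - f x)) =
    (fun h : R => h^-1 *: (f (h *: v + (h *: w + x)) - f (h *: w + x))
     + h^-1 *: ((f \o shift x) (h *: w) - f x)).
  apply/funext => h; rewrite -scalerDr; congr (_ *: _) => /=.
  by rewrite scalerDr -[h *: v + h *: w + x]addrA; ring.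
apply: cvgD; last exact: dw.
apply/cvgrPdist_le => e e0.
have /nbhs_ballP [d /= d0 dP] : \forall z \near x, `|'D_v f x - 'D_v f z| <= e.
  by move/cvgrPdist_le : cv; exact.
pose N := `|v| + `|w| + 1.
have N0 : 0 < N by rewrite ltr_wpDl// addr_ge0.
near=> h.
have hn0 : h != 0 by near: h; exact: nbhs_dnbhs_neq.
have [t t01 ->] := MVT_line (h *: w + x) h dv.
rewrite [_ *: _]mulrA mulVf// mul1r; apply: dP.
rewrite -ball_normE /ball_ /= addrA opprD addrCA subrr addr0 normrN.
apply: (le_lt_trans (ler_normD _ _)); rewrite !normrZ ?normrM.
have hd : `|h| < d / N.
  near: h; apply: dnbhs0_lt; exact: divr_gt0.
have t1 : `|t| <= 1 by rewrite ger0_norm; lra.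
apply: (@le_lt_trans _ _ (`|h| * (`|v| + `|w|))).
  rewrite mulrDr lerD2r ler_wpM2r// ler_piMl//.
move: hd; rewrite ltr_pdivlMr// => hd; apply: le_lt_trans hd.
by rewrite ler_wpM2l// /N lerDl.
Unshelve. all: by end_near.
Qed.

End derive_along_lines.

(** * Smooth functions flat at zero *)

Section flat_functions.
Variable R : realType.
Implicit Types (p : {poly R}) (x y : R).

(** The functions $p(1/x) e^{-1/x}$ on the positive half-line, extended by zero.
    With all polynomials $p$ at once the class is stable under derivation. *)
Definition flat p x : R := if 0 < x then p.[x^-1] * expR (- x^-1) else 0.

Lemma expr_le_expR n y : 0 <= y -> y ^+ n <= n`!%:R * expR y.
Proof.
move=> y0; case: n => [|n].
  by rewrite expr0 fact0 mul1r -expR0 ler_expR.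
rewrite -ler_pdivrMl ?ltr0n ?fact_gt0// mulrC.
by apply: le_trans (expR_ge1Dxn n y0); rewrite lerDr.
Qed.

Lemma horner_expR_bounded p : exists2 C : R, 0 <= C &
  forall y, 0 <= y -> `|p.[y]| * expR (- y) <= C.
Proof.
exists (\sum_(i < size p) `|p`_i| * i`!%:R).
  by apply: sumr_ge0 => i _; rewrite mulr_ge0.
move=> y y0; rewrite horner_coef expRN ler_pdivrMr ?expR_gt0//.
apply: (le_trans (ler_norm_sum _ _ _)); rewrite mulr_suml; apply: ler_sum => i _.
rewrite normrM -mulrA ler_wpM2l// ger0_norm ?exprn_ge0//.
exact: expr_le_expR.
Qed.

Lemma flat_le0 p x : x <= 0 -> flat p x = 0.
Proof. by move=> x0; rewrite /flat ltNge x0. Qed.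

Lemma flat_gt0 p x : 0 < x -> flat p x = p.[x^-1] * expR (- x^-1).
Proof. by move=> x0; rewrite /flat x0. Qed.

Lemma flat_bounded p : exists2 C : R, 0 <= C & forall x, `|flat p x| <= C.
Proof.
have [C C0 Cp] := horner_expR_bounded p; exists C => // x.
have [x0|x0] := ltP 0 x; last by rewrite flat_le0// normr0.
by rewrite flat_gt0// normrM (ger0_norm (expR_ge0 _)) Cp// invr_ge0 ltW.
Qed.

(** The two powers of $x$ are paid for by passing from $p$ to $X^2 p$; they make the
    derivative at the origin vanish. *)
Lemma flat_le_sqr p : exists2 C : R, 0 <= C & forall x, `|flat p x| <= C * x ^+ 2.
Proof.
have [C C0 Cp] := flat_bounded ('X ^+ 2 * p); exists C => // x.
have [x0|x0] := ltP 0 x; last by rewrite flat_le0// normr0 mulr_ge0// sqr_ge0.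
rewrite -ler_pdivrMr ?exprn_gt0//; apply: le_trans (Cp x).
rewrite !flat_gt0// hornerM hornerXn -mulrA [leRHS]normrM exprVn [leRHS]mulrC.
by rewrite ler_wpM2l// ler_norm.
Qed.

Lemma is_derive_flat p x : is_derive x 1 (flat p) (flat ('X ^+ 2 * (p - p^`())) x).
Proof.
have [x0|x0|x0] := ltgtP x 0.
- rewrite flat_le0 ?ltW//; apply: (@near_eq_is_derive _ _ _ (cst 0)).
  by near=> y; rewrite flat_le0//; apply/ltW; near: y; exact: lt_nbhsl.
- have E : is_derive x 1 (fun y => p.[y^-1] * expR (- y^-1))
      (flat ('X ^+ 2 * (p - p^`())) x).
    have xn0 : x != 0 by rewrite gt_eqF.
    have dV : is_derive x 1 (fun y : R => y^-1) (- x ^- 2).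
      by apply: is_derive_eq; [exact: is_deriveV|rewrite [LHS]mulr1].
    have dp : is_derive x 1 (fun y : R => p.[y^-1]) (p^`().[x^-1] * - x ^- 2).
      exact: (@is_derive_comp_line _ _ (horner p) (fun y : R => y^-1) x 1 _ _ (is_derive_poly p _) dV).
    have de : is_derive x 1 (fun y : R => expR (- y^-1)) (expR (- x^-1) * - - x ^- 2).
      have dN : is_derive x 1 (fun y : R => - y^-1) (- - x ^- 2) by exact: is_deriveN.
      exact: (@is_derive_comp_line _ _ expR (fun y : R => - y^-1) x 1 _ _ (is_derive_expR _) dN).
    rewrite (_ : flat _ x = p.[x^-1] *: (expR (- x^-1) * - - x ^- 2) +
      expR (- x^-1) *: (p^`().[x^-1] * - x ^- 2)); first exact: is_deriveM.
    rewrite flat_gt0// !hornerE exprVn /GRing.scale/=; ring.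
  apply: near_eq_is_derive E; near=> y; rewrite flat_gt0//.
  by near: y; exact: lt_nbhsr.
- rewrite x0 flat_le0//; have [C C0 Cp] := flat_le_sqr p.
  have H : (fun h : R => h^-1 *: ((flat p \o shift 0) (h *: 1) - flat p 0)) @ 0^' --> (0 : R).
    apply/cvgrPdist_le => e e0; near=> h.
    have hn0 : h != 0 by near: h; exact: nbhs_dnbhs_neq.
    rewrite sub0r normrN /= [h *: 1]mulr1 addr0 (flat_le0 _ (lexx 0)) subr0.
    rewrite normrM normrV ?unitfE// mulrC ler_pdivrMr ?normr_gt0//.
    apply: (le_trans (Cp h)).
    rewrite -(real_normK (num_real h)) expr2 mulrA ler_wpM2r//.
    have : `|h| < e / (C + 1) by near: h; apply: dnbhs0_lt; rewrite divr_gt0// ltr_wpDl.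
    rewrite ltr_pdivlMr ?ltr_wpDl// => /ltW; apply: le_trans.
    by rewrite mulrC ler_wpM2l// lerDl.
  by split; [exact: (cvgP _ H)|exact: (cvg_lim _ H)].
Unshelve. all: by end_near. Qed.

End flat_functions.

(** * Iterated partial derivatives *)

Section iterated_derivatives.
Variable R : realType.
Implicit Types (f g : space R -> R) (n : nat).
Local Notation cd := (@continuously_differentiable R).

Lemma cd_continuous n f : cd n f -> continuous f.
Proof. by case: n => [|n] []. Qed.

Lemma cd_derivable n f i x : cd n.+1 f -> derivable f x (dir R i).
Proof. by case=> _ /(_ i)[]. Qed.

Lemma cd_partial n f i : cd n.+1 f -> cd n (rpartial i f).
Proof. by case=> _ /(_ i)[]. Qed.

Lemma cdW n f : cd n.+1 f -> cd n f.
Proof.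
elim: n f => [|n IHn] f [cf df]; split => // i; have [d1 d2] := df i.
by split => //; exact: IHn.
Qed.

Lemma cd_is_derive n f i x : cd n.+1 f -> is_derive x (dir R i) f (rpartial i f x).
Proof. by move=> cf; apply: derivableP; exact: cd_derivable cf. Qed.

Lemma rpartialE f i x (df : R) : is_derive x (dir R i) f df -> rpartial i f x = df.
Proof. by move=> h; rewrite /rpartial derive_val. Qed.

(** The induction step of the closure properties that follow. *)
Lemma cdS n f (df : 'I_3 -> space R -> R) : continuous f ->
  (forall i x, is_derive x (dir R i) f (df i x)) -> (forall i, cd n (df i)) ->
  cd n.+1 f.
Proof.
move=> cf dfP cdf; split=> // i; split; first by move=> x; case: (dfP i x).
by rewrite (_ : rpartial i f = df i)//; apply/funext => x; exact: rpartialE.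
Qed.

Lemma cd_cst n (c : R) : cd n (cst c).
Proof.
elim: n c => [|n IHn] c; first by split => // x; exact: cvg_cst.
apply: (@cdS _ _ (fun _ => cst 0)) => //; first by move=> x; exact: cvg_cst.
Qed.

Lemma cdD n f g : cd n f -> cd n g -> cd n (fun x => f x + g x).
Proof.
elim: n f g => [|n IHn] f g cf cg.
  by split => // x; apply: cvgD; [exact: cd_continuous cf _|exact: cd_continuous cg _].
apply: (@cdS _ _ (fun i x => rpartial i f x + rpartial i g x)).
- by move=> x; apply: cvgD; [exact: cd_continuous cf _|exact: cd_continuous cg _].
- by move=> i x; apply: is_deriveD; [exact: cd_is_derive cf|exact: cd_is_derive cg].
- by move=> i; apply: IHn; exact: cd_partial.
Qed.

Lemma cdM n f g : cd n f -> cd n g -> cd n (fun x => f x * g x).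
Proof.
elim: n f g => [|n IHn] f g cf cg.
  by split => // x; apply: cvgM; [exact: cd_continuous cf _|exact: cd_continuous cg _].
apply: (@cdS _ _ (fun i x => f x * rpartial i g x + g x * rpartial i f x)).
- by move=> x; apply: cvgM; [exact: cd_continuous cf _|exact: cd_continuous cg _].
- by move=> i x; apply: is_deriveM; [exact: cd_is_derive cf|exact: cd_is_derive cg].
- move=> i; apply: cdD; apply: IHn; first [exact: cdW|exact: cd_partial].
Qed.

Lemma cdB n f g : cd n f -> cd n g -> cd n (fun x => f x - g x).
Proof.
move=> cf cg; rewrite (_ : (fun x => _) = (fun x => f x + -1 * g x)).
  by apply: cdD => //; apply: cdM => //; exact: cd_cst.
by apply/funext => x; rewrite mulN1r.
Qed.

Lemma cd_flat n (p : {poly R}) g : cd n g -> cd n (fun x => flat p (g x)).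
Proof.
have cF (q : {poly R}) : continuous (flat q).
  move=> y; apply/differentiable_continuous/derivable1_diffP.
  by case: (is_derive_flat q y).
elim: n p g => [|n IHn] p g cg.
  split => // x; apply: (@continuous_comp _ _ _ g (flat p)); [exact: cd_continuous cg _|exact: cF].
apply: (@cdS _ _ (fun i x => flat ('X ^+ 2 * (p - p^`())) (g x) * rpartial i g x)).
- move=> x; apply: (@continuous_comp _ _ _ g (flat p)); [exact: cd_continuous cg _|exact: cF].
- move=> i x; apply: is_derive_comp_line; last exact: cd_is_derive cg.
  exact: is_derive_flat.
- by move=> i; apply: cdM; [apply: IHn; exact: cdW|exact: cd_partial].
Qed.

Lemma cd_shift n (v : space R) f : cd n f -> cd n (fun x => f (x + v)).
Proof.
have cS : continuous (fun x : space R => x + v).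
  by move=> x; apply: cvgD; [exact: cvg_id|exact: cvg_cst].
elim: n f => [|n IHn] f cf.
  by split => // x; apply: cvg_comp; [exact: cS|exact: (cd_continuous cf)].
apply: (@cdS _ _ (fun i x => rpartial i f (x + v))).
- by move=> x; apply: cvg_comp; [exact: cS|exact: (cd_continuous cf)].
- by move=> i x; apply/(is_derive_translate f x (dir R i) v _); exact: cd_is_derive cf.
- by move=> i; apply: IHn; exact: cd_partial.
Qed.

Lemma rpartial_shift n (v : space R) f i x : cd n.+1 f ->
  rpartial i (fun y => f (y + v)) x = rpartial i f (x + v).
Proof.
move=> cf; have := cd_is_derive i (x + v) cf.
by move=> /(is_derive_translate f x (dir R i) v _).1[_ E]; exact: E.
Qed.

Lemma continuous_affine (a b c e : R) :
  continuous (fun x : space R => a * x.1.1 + b * x.1.2 + c * x.2 + e).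
Proof.
have c1 : continuous (fun x : space R => x.1.1).
  by move=> x; apply: (@cvg_comp _ _ _ fst fst) cvg_fst _; exact: cvg_fst.
have c2 : continuous (fun x : space R => x.1.2).
  by move=> x; apply: (@cvg_comp _ _ _ fst snd) cvg_fst _; exact: cvg_snd.
have c3 : continuous (fun x : space R => x.2) by move=> x; exact: cvg_snd.
move=> x; apply: cvgD; last exact: cvg_cst.
apply: cvgD; first apply: cvgD; (apply: cvgM; first exact: cvg_cst).
- exact: c1.
- exact: c2.
- exact: c3.
Qed.

Lemma is_derive_affine (a b c e : R) (x v : space R) :
  is_derive x v (fun x : space R => a * x.1.1 + b * x.1.2 + c * x.2 + e)
    (a * v.1.1 + b * v.1.2 + c * v.2).
Proof.
apply/is_derive_line0.
pose m := a * v.1.1 + b * v.1.2 + c * v.2.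
pose k := a * x.1.1 + b * x.1.2 + c * x.2 + e.
have -> : (fun r : R => (fun x : space R => a * x.1.1 + b * x.1.2 + c * x.2 + e) (r *: v + x))
    = (fun r : R => (m *: (id : R -> R)) r + cst k r).
  apply/funext => r.
  rewrite (_ : (r *: v + x).1.1 = r * v.1.1 + x.1.1)//.
  rewrite (_ : (r *: v + x).1.2 = r * v.1.2 + x.1.2)//.
  rewrite (_ : (r *: v + x).2 = r * v.2 + x.2)//.
  rewrite (_ : (m *: id) r = m * r)// /m /k /cst; ring.
apply: is_derive_eq; by rewrite addr0 [LHS]mulr1.
Qed.

Lemma cd_affine n (a b c e : R) :
  cd n (fun x : space R => a * x.1.1 + b * x.1.2 + c * x.2 + e).
Proof.
case: n => [|n]; first by split => //; exact: continuous_affine.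
apply: (@cdS _ _ (fun i _ => a * (dir R i).1.1 + b * (dir R i).1.2 + c * (dir R i).2)).
- exact: continuous_affine.
- by move=> i x; exact: is_derive_affine.
- by move=> i; exact: cd_cst.
Qed.

(** When [g] is the gradient of a function, its derivative in the direction
    [(k1, k2, k3)]. *)
Definition ddir (k1 k2 k3 : R) (g : 'I_3 -> space R -> R) (x : space R) : R :=
  k1 * g 0 x + k2 * g 1 x + k3 * g 2%:R x.

(** Linearity in the direction comes from the continuity of the partial
    derivatives. *)
Lemma cd_is_derive_dir n f (k1 k2 k3 : R) x : cd n.+1 f ->
  is_derive x (k1, k2, k3) f (ddir k1 k2 k3 (fun i => rpartial i f) x).
Proof.
move=> cf.
have d i c y : is_derive y (c *: dir R i) f (c * rpartial i f y).
  by apply: is_deriveZdir; exact: cd_is_derive cf.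
have cD i c : continuous (fun y => 'D_(c *: dir R i) f y).
  have -> : (fun y => 'D_(c *: dir R i) f y) = (fun y => c * rpartial i f y).
    by apply/funext => y; exact: derive_val.
  by move=> y; apply: cvgM; [exact: cvg_cst|exact: cd_continuous (cd_partial i cf) _].
have -> : (k1, k2, k3) = k1 *: dir R 0 + (k2 *: dir R 1 + k3 *: dir R 2%:R).
  by congr (_, _, _); rewrite /dir/= /GRing.scale/=; ring.
have d23 y : is_derive y (k2 *: dir R 1 + k3 *: dir R 2%:R) f
    (k2 * rpartial 1 f y + k3 * rpartial 2%:R f y).
  have [] := @is_deriveDdir _ _ f y (k2 *: dir R 1) (k3 *: dir R 2%:R).
  - by move=> z; case: (d 1 k2 z).
  - exact: cD.
  - by case: (d 2%:R k3 y).
  by rewrite !derive_val => *; split.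
have [] := @is_deriveDdir _ _ f x (k1 *: dir R 0) (k2 *: dir R 1 + k3 *: dir R 2%:R).
- by move=> z; case: (d 0 k1 z).
- exact: cD.
- by case: (d23 x).
by rewrite !derive_val /ddir -addrA => *; split.
Qed.

End iterated_derivatives.

(** * Real test functions *)

Section real_test_functions.
Variable R : realType.
Implicit Types (O : set (space R)) (f g phi : space R -> R).
Local Notation cd := (@continuously_differentiable R).

(** The support condition asks for a compact set outside which [phi] vanishes: in
    this form it passes to products, derivatives and translates without the
    computation of a closure. *)
Definition rtest O phi : Prop :=
  (forall n, cd n phi) /\
  exists2 K, compact K & [set x | phi x != 0] `<=` K /\ K `<=` O.

Lemma compact_closed_space (K : set (space R)) : compact K -> closed K.
Proof. by apply: compact_closed; exact: norm_hausdorff. Qed.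

Lemma rtest_test_function O phi : rtest O phi ->
  test_function O (fun x => phi x +i* 0)%C.
Proof.
move=> [sphi [K cK [phiK KO]]].
have sK : supp (fun x => phi x +i* 0)%C `<=` K.
  rewrite [X in _ `<=` X](closure_id K).1; last exact: compact_closed_space.
  apply: closureS => x /= h; apply: phiK => /=; apply: contra h => /eqP ->.
  exact: eqxx.
split.
- by move=> n; split; [exact: sphi|exact: cd_cst].
- by apply: subclosed_compact cK sK; exact: closed_closure.
- exact: subset_trans sK KO.
Qed.

Lemma rtest_re O (f : space R -> R[i]) : test_function O f -> rtest O (re f).
Proof.
move=> [sf cf fO]; split; first by move=> n; case: (sf n).
exists (supp f) => //; split=> // x /= h; apply: subset_closure => /=.
by apply: contra h => /eqP; rewrite /re => ->.
Qed.

Lemma rtest_im O (f : space R -> R[i]) : test_function O f -> rtest O (im f).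
Proof.
move=> [sf cf fO]; split; first by move=> n; case: (sf n).
exists (supp f) => //; split=> // x /= h; apply: subset_closure => /=.
by apply: contra h => /eqP; rewrite /im => ->.
Qed.

Lemma rtest_notin O phi x : rtest O phi -> ~ O x -> phi x = 0.
Proof.
move=> [_ [K _ [phiK KO]]] nOx; apply/eqP; apply: contra_notT nOx => h.
exact/KO/phiK.
Qed.

Lemma rtest_partial O phi i : rtest O phi -> rtest O (rpartial i phi).
Proof.
move=> [sphi [K cK [phiK KO]]]; split; first by move=> n; exact: cd_partial.
exists K => //; split=> // x /=; apply: contraNP => nKx.
have nx : \forall y \near x, phi y = 0.
  have oK : open (~` K) by apply: closed_openC; exact: compact_closed_space.
  have : nbhs x (~` K) by exact: open_nbhs_nbhs.
  apply: filterS => y nKy; apply/eqP; apply: contra_notT nKy => h; exact: phiK.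
apply/eqP; apply: rpartialE.
apply: (@near_eq_is_derive _ _ _ (cst 0) phi) => //.
by apply: filterS nx => y ->.
Qed.

Lemma rtest_cd O phi n : rtest O phi -> cd n phi.
Proof. by case. Qed.

Lemma rtest_continuous O phi : rtest O phi -> continuous phi.
Proof. by move=> /rtest_cd h; exact: cd_continuous (h 0%N). Qed.

Lemma rtest_bounded O phi : rtest O phi -> exists2 C : R, 0 < C & forall x, `|phi x| <= C.
Proof.
move=> tphi; have [sphi [K cK [phiK KO]]] := tphi.
have : compact (phi @` K).
  apply: continuous_compact => //; apply: continuous_subspaceT.
  exact: rtest_continuous tphi.
move=> /compact_bounded [M [Mr Mb]].
pose C := `|M| + 1.
have C0 : 0 < C by rewrite /C ltr_wpDl.
have MC : M < C by rewrite /C (le_lt_trans (ler_norm M))// ltrDl.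
exists C => // x.
have [Kx|nKx] := pselect (K x); first by apply: (Mb C MC); exists x.
have -> : phi x = 0 by apply/eqP; apply: contra_notT nKx => h; exact: phiK.
by rewrite normr0 ltW.
Qed.

Lemma rtest_sqi O phi : rtest O phi -> sqi (leb3 : {measure set (mspace R) -> \bar R}) phi.
Proof.
move=> tphi; have [C C0 Cphi] := rtest_bounded tphi.
have [sphi [K cK [phiK KO]]] := tphi.
have mphi : measurable_fun setT (phi : mspace R -> R).
  by apply: continuous_measurable_space; exact: rtest_continuous tphi.
split => //.
have [M [Mr Mb]] := compact_bounded cK.
pose N := `|M| + 1.
have MN : M < N by rewrite /N (le_lt_trans (ler_norm M))// ltrDl.
pose I : set (measurableTypeR R) := `[- N, N]%classic.
pose B : set (mspace R) := (I `*` I) `*` I.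
have KB x : K x -> B x.
  move=> Kx; have /= := Mb N MN x Kx; rewrite prod_normE ge_max => /andP[].
  rewrite prod_normE ge_max => /andP[h1 h2] h3.
  by split; [split|]; rewrite /I/= in_itv/= -ler_norml.
have mI : measurable I by exact: measurable_itv.
have mB : measurable B by apply: measurableX => //; exact: measurableX.
have IN : (lebesgue_measure I < +oo)%E.
  by rewrite /I lebesgue_measure_itv/=; case: ifP => _ //; rewrite -EFinB ltry.
have IIN : (leb2 (I `*` I) < +oo)%E.
  by rewrite /leb2 product_measure1E// lte_mul_pinfty// ge0_fin_numE.
have BN : (leb3 B < +oo)%E.
  rewrite /leb3 product_measure1E//; last exact: measurableX.
  by rewrite lte_mul_pinfty// ge0_fin_numE.
apply: (@le_lt_trans _ _ (\int[leb3]_(x in B) (C ^+ 2)%:E)%E).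
  rewrite [leRHS]integral_mkcond; apply: ge0_le_integral => //.
  - by move=> x _; rewrite lee_fin sqr_ge0.
  - by apply/measurable_EFinP; exact: measurable_funX.
  - by apply/(measurable_restrictT _ _).1 => //; exact: measurable_cst.
  - move=> x _; rewrite patchE; case: ifPn => [_|/negP nBx].
      rewrite lee_fin -(real_normK (num_real (phi x))) lerXn2r ?nnegrE// ltW//.
    have -> : phi x = 0; last by rewrite expr0n.
    by apply/eqP; apply: contra_notT nBx => h; rewrite inE; exact/KB/phiK.
rewrite integral_cst// lte_mul_pinfty// lee_fin sqr_ge0//.
Qed.

Lemma rtestM O O' phi (chi : space R -> R) (A : set (space R)) :
  rtest O phi -> (forall n, cd n chi) -> closed A ->
  (forall x, chi x != 0 -> A x) -> O `&` A `<=` O' -> rtest O' (fun x => chi x * phi x).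
Proof.
move=> [sphi [K cK [phiK KO]]] schi cA chiA OA; split.
  by move=> n; exact: cdM.
exists (K `&` A).
  apply: (subclosed_compact _ cK); last exact: subIsetl.
  by apply: closedI => //; exact: compact_closed_space.
split=> x /=; last by move=> [Kx Ax]; apply: OA; split => //; exact: KO.
by rewrite mulf_eq0 negb_or => /andP[cx px]; split; [exact: phiK|exact: chiA].
Qed.

Lemma rtest_shift O O' phi (v : space R) : rtest O phi ->
  (forall x, O x -> O' (x - v)) -> rtest O' (fun x => phi (x + v)).
Proof.
move=> [sphi [K cK [phiK KO]]] OO'; split; first by move=> n; exact: cd_shift.
exists ((fun x : space R => x - v) @` K).
  apply: continuous_compact => //; apply: continuous_subspaceT => x.
  by apply: cvgB; [exact: cvg_id|exact: cvg_cst].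
split=> [x /= h|_ /= [x Kx <-]]; last exact/OO'/KO.
by exists (x + v); [exact: phiK|rewrite addrK].
Qed.

End real_test_functions.

(** * Translations along the first axis *)

Section sigma_finite_leb3.
Variable R : realType.

Lemma sigma_finite_leb3 : sigma_finite setT (@leb3 R).
Proof.
have /sigma_finiteP[F [TF ndF Foo]] := sigma_finiteT (@leb2 R).
have /sigma_finiteP[G [TG ndG Goo]] := sigma_finiteT (@lebesgue_measure R).
exists (fun n => F n `*` G n).
  rewrite -setXTT TF TG predeqE => -[x y]; split.
    move=> [/= [n _ Fnx] [k _ Gky]]; exists (maxn n k) => //; split.
    - by move: x Fnx; exact/subsetPset/ndF/leq_maxl.
    - by move: y Gky; exact/subsetPset/ndG/leq_maxr.
  by move=> [n _ []/= ? ?]; split; exists n.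
move=> k; have [mF Fk] := Foo k; have [mG Gk] := Goo k; split; first exact: measurableX.
by rewrite /leb3 product_measure1E// lte_mul_pinfty// ge0_fin_numE.
Qed.

HB.instance Definition _ :=
  Measure_isSigmaFinite.Build _ _ _ (@leb3 R) sigma_finite_leb3.

End sigma_finite_leb3.

Section increments.
Variable R : realType.
Local Notation leb := (@lebesgue_measure R).
Local Notation L3 := (leb3 : {measure set (mspace R) -> \bar R}).
Implicit Types (f g phi : space R -> R).

(** The Cauchy-Schwarz inequality for the integral of [dg], obtained by integrating
    $(g' - c)^2 \geq 0$ where $c$ is the mean slope. *)
Lemma sqr_increment_le (g dg : R -> R) (y : R) :
  (forall r : R, is_derive r 1 g (dg r)) -> continuous dg -> 0 < y ->
  (((g y - g 0) ^+ 2)%:E <= y%:E * \int[leb]_(r in `[0%R, y]) (dg r ^+ 2)%:E)%E.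
Proof.
move=> dgP cdg y0.
have cg : continuous g.
  by move=> r; apply/differentiable_continuous/derivable1_diffP; case: (dgP r).
have E : (\int[leb]_(r in `[0%R, y]) (dg r)%:E = (g y)%:E - (g 0)%:E)%E.
  apply: continuous_FTC2 => //.
  - exact: continuous_subspaceT.
  - split.
    + by move=> r _; case: (dgP r).
    + by apply: cvg_at_right_filter; exact: cg.
    + by apply: cvg_at_left_filter; exact: cg.
  - by move=> r _; rewrite derive1E; case: (dgP r).
have int (h : R -> R) : continuous h -> leb.-integrable `[0%R, y] (EFin \o h).
  move=> ch; apply: continuous_compact_integrable; first exact: segment_compact.
  exact: continuous_subspaceT.
have i1 := int _ cdg.
have c2 : continuous (fun r => dg r ^+ 2).
  move=> r; apply: (@cvg_comp _ _ _ dg (fun z => z ^+ 2)); first exact: cdg.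
  exact: exprn_continuous.
have i2 := int _ c2.
(* the mean slope *)
set c := (g y - g 0) / y.
have c3 : continuous (fun r => c *+ 2 * dg r - c ^+ 2).
  move=> r; apply: cvgB; last exact: cvg_cst.
  by apply: cvgM; [exact: cvg_cst|exact: cdg].
have mI : measurable (`[0%R, y]%classic : set (measurableTypeR R)) by exact: measurable_itv.
have muI : fine (leb `[0%R, y]%classic) = y.
  by rewrite lebesgue_measure_itv/= lte_fin y0 -EFinB subr0.
have H : \int[leb]_(r in `[0%R, y]) (c *+ 2 * dg r - c ^+ 2) <=
    \int[leb]_(r in `[0%R, y]) (dg r ^+ 2).
  apply: le_Rintegral => //; first exact: int.
  move=> r _; have := sqr_ge0 (dg r - c); nra.
have i4 : leb.-integrable `[0%R, y] (EFin \o (fun r => c *+ 2 * dg r)).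
  by apply: int => r; apply: cvgM; [exact: cvg_cst|exact: cdg].
have i5 : leb.-integrable `[0%R, y] (EFin \o (fun r => c ^+ 2)).
  by apply: int => r; exact: cvg_cst.
move: H; rewrite RintegralB// RintegralZl// Rintegral_cst// muI.
have -> : \int[leb]_(r in `[0%R, y]) dg r = g y - g 0 by rewrite /Rintegral E.
move=> H.
have <- : (\int[leb]_(r in `[0%R, y]) (dg r ^+ 2))%:E =
    (\int[leb]_(r in `[0%R, y]) (dg r ^+ 2)%:E)%E.
  by rewrite /Rintegral fineK//; exact: integrable_fin_num i2.
rewrite -EFinM lee_fin.
have cy : g y - g 0 = c * y by rewrite /c divfK// gt_eqF.
rewrite cy in H *.
nra.
Qed.

Lemma continuous_line (y v : space R) : continuous (fun r : R => r *: v + y).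
Proof.
by move=> r; apply: cvgD; [exact: scalel_continuous|exact: cvg_cst].
Qed.

Lemma sqr_increment_line_le f (df : space R -> R) (y v : space R) (t : R) :
  (forall z, is_derive z v f (df z)) -> continuous df -> 0 < t ->
  (((f (t *: v + y) - f y) ^+ 2)%:E <=
   t%:E * \int[leb]_(r in `[0%R, t]) (df (r *: v + y) ^+ 2)%:E)%E.
Proof.
move=> dfP cdf t0.
pose dg (r : R) := df (r *: v + y).
have dgP (r : R) : is_derive r 1 (fun r : R => f (r *: v + y)) (dg r).
  by apply: (is_derive_line f y v r (dg r)).1; exact: dfP.
have cdg : continuous dg.
  by move=> r; apply: cvg_comp; [exact: continuous_line|exact: cdf].
by have := sqr_increment_le dgP cdg t0; rewrite scale0r add0r.
Qed.

Definition tr (t : R) f : space R -> R := fun x => f (x + (- t, 0, 0)).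

Lemma measurable_translate (t : R) :
  measurable_fun setT ((fun x : space R => x + (t, 0, 0)) : mspace R -> mspace R).
Proof.
apply: measurable_fun_pair; first apply: measurable_fun_pair.
- apply: (measurableT_comp (measurable_shift t)); exact: measurableT_comp.
- apply: (measurableT_comp (measurable_shift 0)); exact: measurableT_comp.
- exact: (measurableT_comp (measurable_shift 0)).
Qed.

Lemma ge0_integral_tr (t : R) (F : mspace R -> \bar R) :
  measurable_fun setT F -> (forall x, 0 <= F x)%E ->
  (\int[leb3]_x F ((x : space R) + (t, 0, 0))%R = \int[leb3]_x F x)%E.
Proof.
move=> mF F0; rewrite -[RHS](ge0_integral_leb3_shift mF F0 t).
apply: eq_integral => x _; congr F.
by rewrite -[RHS]/(x.1.1 + t, x.1.2, x.2)%R; congr (_, _, _); rewrite addr0.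
Qed.

Lemma sqi_tr (t : R) f : sqi L3 f -> sqi L3 (tr t f).
Proof.
move=> [mf fi]; split; first exact: (measurableT_comp mf (measurable_translate (- t))).
rewrite (ge0_integral_tr (- t) (F := fun x => (f x ^+ 2)%:E))//.
  by apply/measurable_EFinP; exact: measurable_funX.
by move=> x; rewrite lee_fin sqr_ge0.
Qed.

Lemma ip_tr_sqr (t : R) f : sqi L3 f -> ip L3 (tr t f) (tr t f) = ip L3 f f.
Proof.
move=> sf; apply: EFin_inj; rewrite -!ip_sqr//; last exact: sqi_tr.
apply: (ge0_integral_tr (- t) (F := fun x => (f x ^+ 2)%:E)).
  by apply/measurable_EFinP; apply: measurable_funX; case: sf.
by move=> x; rewrite lee_fin sqr_ge0.
Qed.

(** Nonnegative integrals are translation invariant, hence norms are, and the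
    products follow by polarization. *)
Lemma ip_tr (t : R) f g : sqi L3 f -> sqi L3 g ->
  ip L3 (tr t f) (tr t g) = ip L3 f g.
Proof.
move=> sf sg.
have := ip_tr_sqr t (sqiB sf (sqiZ 1 sg)).
have -> : tr t (fun x => f x - 1 * g x) = (fun x => tr t f x - 1 * tr t g x) by [].
rewrite !ip_quad//; try exact: sqi_tr.
by rewrite !ip_tr_sqr//; lra.
Qed.

Lemma rtest_tr O O' phi t : rtest O phi ->
  (forall x, O x -> O' (x + (t, 0, 0))) -> rtest O' (tr t phi).
Proof.
move=> tphi OO'; apply: rtest_shift tphi _ => x /OO'.
by rewrite (_ : x + (t, 0, 0) = x - (- t, 0, 0))//; congr (_, _, _) => /=; rewrite ?opprK ?oppr0.
Qed.

Lemma rpartial_tr O phi t i : rtest O phi -> rpartial i (tr t phi) = tr t (rpartial i phi).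
Proof.
by move=> tphi; apply/funext => x; apply: (rpartial_shift _ _ _ (rtest_cd 1 tphi)).
Qed.

(** The squared increment at a point is at most $t$ times the integral of the
    squared derivative over the segment of length $t$ that ends there. Integrate
    over the point and exchange the integrals: each of the translates of the
    derivative under the integral sign has the same norm. *)
Lemma ip_tr_sub_le O phi t : 0 < t -> rtest O phi ->
  ip L3 (fun x => phi x - tr t phi x) (fun x => phi x - tr t phi x) <=
  t ^+ 2 * ip L3 (rpartial 0 phi) (rpartial 0 phi).
Proof.
move=> t0 tphi; have sphi := rtest_sqi tphi.
have td := rtest_partial 0 tphi; have sd := rtest_sqi td.
have md : measurable_fun setT (rpartial 0 phi : mspace R -> R) by case: sd.
rewrite -lee_fin EFinM -!ip_sqr//; last by apply: sqiB => //; exact: sqi_tr.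
pose I : set (measurableTypeR R) := `[0%R, t]%classic.
have mI : measurable I by exact: measurable_itv.
have mind : measurable_fun setT (\1_I : measurableTypeR R -> R) by exact: measurable_indic.
pose H (q : mspace R * measurableTypeR R) : \bar R :=
  ((rpartial 0 phi ((q.1 : space R) + (q.2 - t, 0, 0))%R ^+ 2)%:E * (\1_I q.2)%:E)%E.
have H0 q : (0 <= H q)%E by rewrite mule_ge0// lee_fin// sqr_ge0.
have mH : measurable_fun setT H.
  apply: emeasurable_funM; apply/measurable_EFinP; last first.
    exact: (measurableT_comp mind measurable_snd).
  apply: measurable_funX; apply: (measurableT_comp md).
  apply: measurable_fun_pair; first apply: measurable_fun_pair.
  - apply: measurable_funD => /=; first by do 2! apply: measurableT_comp => //.
    exact: (measurableT_comp (measurable_shift (- t))).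
  - apply: (measurableT_comp (measurable_shift 0)); by do 2! apply: measurableT_comp => //.
  - apply: (measurableT_comp (measurable_shift 0)); exact: measurableT_comp.
have K x : (((phi x - tr t phi x) ^+ 2)%:E <= t%:E * \int[leb]_r H (x, r))%E.
  have dirE : dir R 0 = (1, 0, 0) by [].
  have := sqr_increment_line_le (x + (- t, 0, 0))
    (fun z => cd_is_derive 0 z (rtest_cd 1 tphi)) (rtest_continuous td) t0.
  rewrite dirE (_ : t *: (1, 0, 0) + (x + (- t, 0, 0)) = x); last first.
    by rewrite addrCA (_ : t *: (1, 0, 0) + (- t, 0, 0) = 0) ?addr0//;
      congr (_, _, _) => /=; rewrite /GRing.scale/=; ring.
  move=> /le_trans; apply.
  rewrite le_eqVlt; apply/orP; left; apply/eqP; congr (_ * _)%E.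
  rewrite [LHS]integral_mkcond; apply: eq_integral => r _.
  rewrite /H patchE indicE; case: ifPn => rI; rewrite ?mule0//.
  rewrite mule1; congr ((rpartial 0 phi _ ^+ 2)%:E).
  rewrite addrCA; congr (x + _).
  by congr (_, _, _) => /=; rewrite /GRing.scale/=; ring.
apply: (@le_trans _ _ (\int[leb3]_x (t%:E * \int[leb]_r H (x, r)))%E).
  apply: ge0_le_integral => //.
  - by move=> x _; rewrite lee_fin sqr_ge0.
  - apply/measurable_EFinP; apply: measurable_funX; apply: measurable_funB; first by case: sphi.
    by case: (sqi_tr t sphi).
  - apply: emeasurable_funM => //.
    exact: (measurable_fun_fubini_tonelli_F (m2 := leb) H mH H0).
rewrite ge0_integralZl//; last 3 first.
- exact: (measurable_fun_fubini_tonelli_F (m2 := leb) H mH H0).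
- by move=> x _; apply: integral_ge0.
- by rewrite lee_fin ltW.
rewrite (fubini_tonelli (m1 := leb3) (m2 := leb) H mH H0).
have -> : (\int[leb]_r \int[leb3]_x H (x, r) =
    \int[leb]_r ((\int[leb3]_x (rpartial 0 phi x ^+ 2)%:E) * (\1_I r)%:E))%E.
  apply: eq_integral => r _.
  pose f x := (rpartial 0 phi ((x : space R) + (r - t, 0, 0))%R ^+ 2)%:E.
  have mf : measurable_fun setT (f : mspace R -> \bar R).
    apply/measurable_EFinP; apply: measurable_funX.
    exact: (measurableT_comp md (measurable_translate (r - t))).
  have f0 (x : mspace R) : (0 <= f x)%E by rewrite lee_fin sqr_ge0.
  transitivity (\int[leb3]_x (f x * (\1_I r)%:E))%E; first by [].
  rewrite (ge0_integralZr L3 measurableT mf (fun x _ => f0 x)); last by rewrite lee_fin.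
  apply: (congr1 (fun z => z * (\1_I r)%:E)%E
    (ge0_integral_tr (r - t) (F := fun x => (rpartial 0 phi x ^+ 2)%:E) _ _)).
    by apply/measurable_EFinP; apply: measurable_funX.
  by move=> x; rewrite lee_fin sqr_ge0.
rewrite ge0_integralZl//; [|exact/measurable_EFinP|
  by apply: integral_ge0 => x _; rewrite lee_fin sqr_ge0].
have lI : leb I = t%:E by rewrite /I lebesgue_measure_itv/= lte_fin t0 -EFinB subr0.
rewrite integral_indic// setIT [X in (_ * (_ * X))%E]lI.
by rewrite ip_sqr// -!EFinM lee_fin; lra.
Qed.

End increments.

(** * Strips along a face *)

Section strips.
Variables (R : realType) (k1 k2 : R).
Local Notation leb := (@lebesgue_measure R).
Local Notation L3 := (leb3 : {measure set (mspace R) -> \bar R}).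
Local Notation Om := (layer k1 k2).
Local Notation area := (planes_area k1 k2 : {measure set (mspace R) -> \bar R}).

Lemma closed_measurable_space (U : set (space R)) :
  closed U -> measurable (U : set (mspace R)).
Proof.
move=> cU; rewrite -[U]setCK; apply: measurableC; apply: open_measurable_space.
exact: closed_openC.
Qed.

Lemma measurable_boundary (U : set (space R)) : measurable (boundary U : set (mspace R)).
Proof.
apply: measurableD.
  by apply: closed_measurable_space; exact: closed_closure.
by apply: open_measurable_space; exact: open_interior.
Qed.

Lemma area_ge_face (P : mplane R -> mspace R) (A : set (mplane R)) (F : mspace R -> \bar R) :
  measurable_fun setT P ->
  (forall B, measurable B -> (pushforward leb2 P B <= planes_area k1 k2 B)%E) ->
  measurable A -> A `<=` P @^-1` (boundary Om) ->
  measurable_fun setT F -> (forall x, 0 <= F x)%E ->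
  (\int[leb2]_(p in A) F (P p) <= \int[area]_(x in boundary Om) F x)%E.
Proof.
move=> mP leP mA AP mF F0.
have mB := measurable_boundary Om.
have mPB : measurable (P @^-1` (boundary Om)) by rewrite -[X in measurable X]setTI; exact: mP.
have mFP : measurable_fun setT (F \o P) by exact: measurableT_comp.
apply: (@le_trans _ _ (\int[leb2]_(p in P @^-1` (boundary Om)) F (P p))%E).
  by apply: ge0_subset_integral => //; exact: measurable_funTS.
have := @ge0_integral_pushforward _ _ _ _ R P mP leb2 (boundary Om) F mB.
move=> /(_ _ _)/esym => H; rewrite [leLHS]H//; last exact: measurable_funTS.
by apply: ge0_le_measure_integral.
Qed.

(** The strip along a face is the disjoint union of the segments issued from the
    points [q p] of the face, with [p] in [A], in the direction [d]; [ell] is the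
    abscissa along them. *)
Variables (q : mplane R -> mspace R) (d : space R) (ell : space R -> R).
Variables (A : set (mplane R)).
Local Notation line s p := (s *: d + (q p : space R)).
Hypothesis mline : measurable_fun setT
  ((fun z : mplane R * measurableTypeR R => line (z.2 : R) z.1) :
     mplane R * measurableTypeR R -> mspace R).
Hypothesis mq : measurable_fun setT q.
Hypothesis lineI : forall F : mspace R -> \bar R, measurable_fun setT F ->
  (forall x, 0 <= F x)%E ->
  (\int[leb3]_x F x = \int[leb2]_p \int[leb]_s F (line (s : R) p))%E.
Hypothesis lineP : forall p (s e : R), e <= 1 ->
  (Om (line s p) /\ ell (line s p) < e) <-> (A p /\ 0 < s < e).
Hypothesis mA : measurable A.
Hypothesis areaA : forall F : mspace R -> \bar R, measurable_fun setT F ->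
  (forall x, 0 <= F x)%E ->
  (\int[leb2]_(p in A) F (q p) <= \int[area]_(x in boundary Om) F x)%E.
Hypothesis mstrip : forall e, measurable ([set x | Om x /\ ell x < e] : set (mspace R)).

Definition strip e : set (mspace R) := [set x | Om x /\ ell x < e].

Section functions.
Variables (phi dphi : space R -> R) (e : R).
Hypotheses (e0 : 0 < e) (e1 : e <= 1).
Hypotheses (cphi : continuous phi) (cdphi : continuous dphi).
Hypothesis dphiP : forall z, is_derive z d phi (dphi z).

Let slice (f : space R -> R) (p : mplane R) : \bar R :=
  (\int[leb]_(s in `[0%R, e]) (f (line (s : R) p) ^+ 2)%:E)%E.

Let sq_measurable (f : space R -> R) : continuous f ->
  measurable_fun setT ((fun x => (f x ^+ 2)%:E) : mspace R -> \bar R).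
Proof.
move=> cf; apply/measurable_EFinP; apply: measurable_funX.
exact: continuous_measurable_space.
Qed.

Let strip_measurable (F : mspace R -> \bar R) :
  measurable_fun setT F -> measurable_fun setT (F \_ (strip e)).
Proof.
by move=> mF; apply: (measurable_restrictT F (mstrip e)).1; exact: measurable_funTS.
Qed.

Let strip_slice (f : space R -> R) (p : mplane R) : continuous f ->
  (\int[leb]_s (((fun x => (f x ^+ 2)%:E) \_ (strip e)) (line (s : R) p)) =
   ((slice f) \_ A) p)%E.
Proof.
move=> cf; rewrite [RHS]patchE; case: ifPn => [|/negP] pA.
  rewrite inE in pA.
  transitivity (\int[leb]_(s in `]0%R, e[) (f (line (s : R) p) ^+ 2)%:E)%E; last first.
    apply/esym/(@integral_itv_bndoo _ 0 e _ true false).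
    apply: measurable_funTS; apply/measurable_EFinP; apply: measurable_funX.
    apply: continuous_measurable_fun => s; apply: cvg_comp; last exact: cf.
    exact: continuous_line.
  rewrite [RHS]integral_mkcond; apply: eq_integral => s _; rewrite !patchE.
  have [_ H] := lineP p s e1.
  congr (if _ then _ else _); apply/idP/idP; rewrite !inE/= ?in_itv/=.
    by move=> /(lineP p s e1) [].
  by move=> s0e; apply: H.
rewrite inE in pA.
transitivity (\int[leb]_s (0 : \bar R))%E; last exact: integral0.
apply: eq_integral => s _; rewrite patchE; case: ifPn => //.
by rewrite inE/= => /(lineP p s e1) [].
Qed.

Let strip_integral (f : space R -> R) : continuous f ->
  (\int[leb3]_(x in strip e) (f x ^+ 2)%:E = \int[leb2]_(p in A) slice f p)%E.
Proof.
move=> cf; rewrite integral_mkcond lineI; first last.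
- by move=> x; rewrite patchE; case: ifP => // _; rewrite lee_fin sqr_ge0.
- by apply: strip_measurable; exact: sq_measurable.
rewrite [RHS]integral_mkcond; apply: eq_integral => p _.
exact: strip_slice.
Qed.

Let slice_measurable (f : space R -> R) : continuous f -> measurable_fun A (slice f).
Proof.
move=> cf; apply: (measurable_restrictT (slice f) mA).2.
rewrite (_ : slice f \_ A = fun p => \int[leb]_s (((fun x => (f x ^+ 2)%:E) \_ (strip e)) (line (s : R) p)))%E.
  apply: (measurable_fun_fubini_tonelli_F (m2 := leb) (fun z : mplane R * measurableTypeR R =>
    ((fun x => (f x ^+ 2)%:E) \_ (strip e)) (line (z.2 : R) z.1))).
    apply: (@measurableT_comp _ _ _ _ _ _ ((fun x => (f x ^+ 2)%:E) \_ (strip e))) mline.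
    by apply: strip_measurable; exact: sq_measurable.
  by move=> x; rewrite patchE; case: ifP => // _; rewrite lee_fin sqr_ge0.
by apply/funext => p; rewrite strip_slice.
Qed.

Let slice_ge0 f p : (0 <= slice f p)%E.
Proof. by apply: integral_ge0 => s _; rewrite lee_fin sqr_ge0. Qed.

(** On a segment, $\phi(q + s d)^2 \leq 2 \phi(q)^2 + 2 (\phi(q + s d) - \phi(q))^2$
    and the last term is at most $2 s \int_0^s (\partial_d \phi)^2$. *)
Let slice_le p :
  (slice phi p <= (2 * e)%:E * (phi (q p) ^+ 2)%:E + (2 * e ^+ 2)%:E * slice dphi p)%E.
Proof.
have mline_ (f : space R -> R) : continuous f ->
    measurable_fun setT (fun s : measurableTypeR R => (f (line (s : R) p) ^+ 2)%:E).
  move=> cf; apply/measurable_EFinP; apply: measurable_funX.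
  apply: continuous_measurable_fun => s; apply: cvg_comp; last exact: cf.
  exact: continuous_line.
pose C : \bar R := (2%:E * (phi (q p) ^+ 2)%:E + (2 * e)%:E * slice dphi p)%E.
have mI : measurable (`[0%R, e]%classic : set (measurableTypeR R)) by exact: measurable_itv.
have C0 : (0 <= C)%E.
  apply: adde_ge0; first by rewrite -EFinM lee_fin mulr_ge0// sqr_ge0.
  by apply: mule_ge0 => //; rewrite lee_fin mulr_ge0// ltW.
apply: (@le_trans _ _ (\int[leb]_(s in `[0%R, e]) C)%E).
  apply: ge0_le_integral => //.
  - by move=> s _; rewrite lee_fin sqr_ge0.
  - by apply: measurable_funTS; exact: mline_.
  - move=> s /=; rewrite in_itv/= => /andP[s0 se].
    have [->|sn0] := eqVneq s 0.
      rewrite scale0r add0r /C (@le_trans _ _ (2%:E * (phi (q p) ^+ 2)%:E)%E)//.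
        by rewrite -EFinM lee_fin; have := sqr_ge0 (phi (q p)); lra.
      by rewrite leeDl// mule_ge0// lee_fin mulr_ge0// ltW.
    have sp : 0 < s by rewrite lt_neqAle eq_sym sn0.
    have H := sqr_increment_line_le (q p : space R) dphiP cdphi sp.
    apply: (@le_trans _ _ (2%:E * (phi (q p) ^+ 2)%:E +
       2%:E * ((phi (line s p) - phi (q p)) ^+ 2)%:E)%E).
      rewrite -!EFinM -EFinD lee_fin.
      have := sqr_ge0 (phi (line s p) - 2 * phi (q p)); nra.
    rewrite /C leeD2l// [(2 * e)%:E]EFinM -muleA lee_pmul2l// ?lte_fin//.
    apply: (le_trans H); apply: lee_pmul => //.
    + by apply: integral_ge0 => r _; rewrite lee_fin sqr_ge0.
    apply: ge0_subset_integral => //.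
    + by apply: measurable_funTS; exact: mline_.
    + by move=> r _; rewrite lee_fin sqr_ge0.
    + by move=> r /=; rewrite !in_itv/= => /andP[-> /le_trans]; apply.
have le_ : leb (`[0%R, e]%classic : set (measurableTypeR R)) = e%:E.
  by rewrite lebesgue_measure_itv/= lte_fin e0 -EFinB subr0.
rewrite integral_cst// [X in (_ * X)%E]le_ /C.
rewrite ge0_muleDl; last 2 first.
- by rewrite -EFinM lee_fin mulr_ge0// sqr_ge0.
- by rewrite mule_ge0// lee_fin mulr_ge0// ltW.
apply: leeD.
  by rewrite -!EFinM lee_fin; lra.
rewrite muleAC -EFinM (_ : 2 * e * e = 2 * e ^+ 2)//; ring.
Qed.

Lemma strip_le_area :
  (\int[leb3]_(x in strip e) (phi x ^+ 2)%:E <=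
   (2 * e)%:E * \int[area]_(x in boundary Om) (phi x ^+ 2)%:E +
   (2 * e ^+ 2)%:E * \int[leb3]_(x in strip e) (dphi x ^+ 2)%:E)%E.
Proof.
rewrite !strip_integral//.
have mphiq : measurable_fun A (fun p => (phi (q p) ^+ 2)%:E).
  by apply: measurable_funTS; apply: (measurableT_comp (sq_measurable cphi)).
apply: (@le_trans _ _ (\int[leb2]_(p in A)
   ((2 * e)%:E * (phi (q p) ^+ 2)%:E + (2 * e ^+ 2)%:E * slice dphi p))%E).
  apply: ge0_le_integral => //.
  - exact: slice_measurable.
  - apply: emeasurable_funD; apply: emeasurable_funM => //; exact: slice_measurable.
have e20 : 0 <= 2 * e by rewrite mulr_ge0// ltW.
have e30 : 0 <= 2 * e ^+ 2 by rewrite mulr_ge0// sqr_ge0.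
rewrite ge0_integralD//; first last.
- apply: emeasurable_funM => //; exact: slice_measurable.
- by move=> p _; rewrite mule_ge0// lee_fin.
- by apply: emeasurable_funM.
- by move=> p _; rewrite -EFinM lee_fin mulr_ge0// sqr_ge0.
rewrite !ge0_integralZl//; first last.
- by move=> p _; rewrite lee_fin sqr_ge0.
- exact: slice_measurable.
apply: leeD => //; apply: lee_pmul => //.
- by apply: integral_ge0 => p _; rewrite lee_fin sqr_ge0.
- apply: (areaA (F := fun x => (phi x ^+ 2)%:E)); first exact: sq_measurable.
  by move=> x; rewrite lee_fin sqr_ge0.
Qed.

End functions.
End strips.

(** * The four faces of the layer *)

Section faces.
Variables (R : realType) (k1 k2 : R).
Local Notation leb := (@lebesgue_measure R).
Local Notation L3 := (leb3 : {measure set (mspace R) -> \bar R}).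
Local Notation Om := (layer k1 k2).
Local Notation area := (planes_area k1 k2 : {measure set (mspace R) -> \bar R}).

Lemma open_affine (a b c e : R) :
  open [set x : space R | 0 < a * x.1.1 + b * x.1.2 + c * x.2 + e].
Proof.
apply: (open_comp (f := fun x : space R => a * x.1.1 + b * x.1.2 + c * x.2 + e)
  (D := [set y : R | 0 < y])); last exact: open_gt.
by move=> x _; exact: continuous_affine.
Qed.

Lemma open_layer : open Om.
Proof.
rewrite (_ : Om = [set x : space R | 0 < 1 * x.1.1 + 0 * x.1.2 + (- k1) * x.2 + 0] `&`
  [set x : space R | 0 < 0 * x.1.1 + 1 * x.1.2 + (- k2) * x.2 + 0] `&`
  ([set x : space R | 0 < 0 * x.1.1 + 0 * x.1.2 + 1 * x.2 + 0] `&`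
  [set x : space R | 0 < 0 * x.1.1 + 0 * x.1.2 + (- 1) * x.2 + 1])).
  by apply: openI; apply: openI; exact: open_affine.
apply/seteqP; split=> x /=.
  by move=> [h1 h2 /andP[h3 h4]]; split; split; lra.
by move=> [[h1 h2] [h3 h4]]; split; [lra|lra|apply/andP; split; lra].
Qed.

Lemma measurable_layer : measurable (Om : set (mspace R)).
Proof. by apply: open_measurable_space; exact: open_layer. Qed.

Lemma open_strip (a b c h e : R) :
  open [set x | Om x /\ a * x.1.1 + b * x.1.2 + c * x.2 + h < e].
Proof.
rewrite (_ : [set x | _] = Om `&`
  [set x : space R | 0 < (- a) * x.1.1 + (- b) * x.1.2 + (- c) * x.2 + (e - h)]).
  by apply: openI; [exact: open_layer|exact: open_affine].
by apply/seteqP; split=> x /= [h1 h2]; split => //; lra.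
Qed.

Lemma closure_line (d y : space R) : (forall s, 0 < s < 1 -> Om (s *: d + y)) -> closure Om y.
Proof.
move=> H B By.
have : \forall s \near (0 : R), B (s *: d + y).
  have := @continuous_line R y d 0; rewrite /continuous_at scale0r add0r; exact.
move=> /nbhs_ballP[e /= e0 eB].
pose s := Order.min (e / 2) (1 / 2).
have s0 : 0 < s by rewrite lt_min !divr_gt0.
have se : s <= e / 2 by rewrite ge_min lexx.
have s1 : s <= 1 / 2 by rewrite ge_min lexx orbT.
exists (s *: d + y); split; first by apply: H; lra.
apply: eB; rewrite /ball/= sub0r normrN gtr0_norm//; lra.
Qed.

(** The inequality of [strip_le_area], as a property of a face: the four faces then
    enter the cutoff argument only through [k] and [ell]. *)
Definition controlled_near_face (k : R * R * R) (ell : space R -> R) :=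
  forall (phi : space R -> R) (e : R), rtest setT phi -> 0 < e -> e <= 1 ->
  (\int[leb3]_(x in strip k1 k2 ell e) (phi x ^+ 2)%:E <=
   (2 * e)%:E * \int[area]_(x in boundary Om) (phi x ^+ 2)%:E +
   (2 * e ^+ 2)%:E * \int[leb3]_(x in strip k1 k2 ell e)
     (ddir k.1.1 k.1.2 k.2 (fun i => rpartial i phi) x ^+ 2)%:E)%E.

Lemma continuous_ddir (a b c : R) (g : 'I_3 -> space R -> R) :
  (forall i, continuous (g i)) -> continuous (ddir a b c g).
Proof.
move=> cg x; apply: cvgD; first apply: cvgD; apply: cvgM;
  try exact: cvg_cst; exact: cg.
Qed.

Lemma control_of_line (q : mplane R -> mspace R) (k : R * R * R) (a b c h : R)
    (A : set (mplane R)) (l : mplane R * measurableTypeR R -> mspace R) :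
  let ell := fun x : space R => a * x.1.1 + b * x.1.2 + c * x.2 + h in
  (forall p (s : R), s *: k + (q p : space R) = l (p, s)) ->
  measurable_fun setT l -> measurable_fun setT q ->
  (forall F : mspace R -> \bar R, measurable_fun setT F -> (forall x, 0 <= F x)%E ->
    (\int[leb3]_x F x = \int[leb2]_p \int[leb]_s F (l (p, s)))%E) ->
  (forall p (s e : R), e <= 1 -> (Om (l (p, s)) /\ ell (l (p, s)) < e) <->
    (A p /\ 0 < s < e)) ->
  (forall p, ell (l (p, 0)) = 0) -> measurable A ->
  (forall B, measurable B -> (pushforward leb2 q B <= planes_area k1 k2 B)%E) ->
  controlled_near_face k ell.
Proof.
move=> ell lE ml mq lI lP l0 mA qa phi e tphi e0 e1.
have lP' p (s r : R) : r <= 1 ->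
    (Om (s *: k + (q p : space R)) /\ ell (s *: k + (q p : space R)) < r) <->
    (A p /\ 0 < s < r) by rewrite lE; exact: lP.
(* The segment issued from a point of the face is in the layer, and its origin
   is not, as the strip only contains positive abscissas. *)
have Ab : A `<=` q @^-1` (boundary Om).
  move=> p Ap /=; split.
    apply: (@closure_line k) => s s01.
    by have [_ H] := lP' p s 1 (lexx _); case: H.
  move=> /interior_subset qOm.
  have ell0 : ell (q p : space R) < 1.
    by rewrite -[q p : space R]add0r -(scale0r k) lE l0.
  have := lP' p 0 1 (lexx _); rewrite scale0r add0r => -[H _].
  by have [//|_] := H _; rewrite ltxx.
have cd_ := rtest_cd 1 tphi.
apply: (@strip_le_area R k1 k2 q k ell A) => //.
- rewrite (_ : (fun z => _) = l)//; apply/funext => -[p s]; exact: lE.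
- move=> F mF F0; rewrite lI//.
  by apply: eq_integral => p _; apply: eq_integral => s _; rewrite lE.
- move=> F mF F0; exact: area_ge_face.
- by move=> r; apply: open_measurable_space; exact: open_strip.
- exact: rtest_continuous tphi.
- by apply: continuous_ddir => i; exact: rtest_continuous (rtest_partial i tphi).
- move=> z; have := @cd_is_derive_dir R 0 phi k.1.1 k.1.2 k.2 z cd_.
  by case: (k) => [[? ?] ?].
Qed.

Let lee_sum4 (c1 c2 m1 m2 m3 m4 : \bar R) : (1 <= c1)%E -> (1 <= c2)%E ->
  (0 <= m1)%E -> (0 <= m2)%E -> (0 <= m3)%E -> (0 <= m4)%E ->
  let s := (c1 * m1 + c2 * m2 + m3 + m4)%E in
  [/\ (m1 <= s)%E, (m2 <= s)%E, (m3 <= s)%E & (m4 <= s)%E].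
Proof.
move=> c11 c21 m10 m20 m30 m40.
have h1 : (m1 <= c1 * m1)%E by rewrite -[leLHS]mul1e; exact: lee_wpmul2r.
have h2 : (m2 <= c2 * m2)%E by rewrite -[leLHS]mul1e; exact: lee_wpmul2r.
have g1 := le_trans m10 h1; have g2 := le_trans m20 h2.
split.
- by apply: (le_trans h1); rewrite -!addeA leeDl// !adde_ge0.
- by apply: (le_trans h2); rewrite -!addeA addeCA leeDl// !adde_ge0.
- by rewrite addeAC leeDr// !adde_ge0.
- by rewrite leeDr// !adde_ge0.
Qed.

(** The Jacobians of the slanted planes are at least one. *)
Let planes_area_terms B : measurable B ->
  [/\ (pushforward leb2 (plane1 k1) B <= planes_area k1 k2 B)%E,
      (pushforward leb2 (plane2 k2) B <= planes_area k1 k2 B)%E,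
      (pushforward leb2 (@plane3 R) B <= planes_area k1 k2 B)%E &
      (pushforward leb2 (@plane4 R) B <= planes_area k1 k2 B)%E].
Proof.
move=> mB; have s1 (k : R) : (1 <= (Num.sqrt (1 + k ^+ 2))%:E)%E.
  rewrite lee_fin -[leLHS]sqrtr1 ler_sqrt ?lerDl ?sqr_ge0//.
  by rewrite addr_ge0// sqr_ge0.
by apply: lee_sum4 => //; rewrite /pushforward; exact: measure_ge0.
Qed.

Lemma measurable_half_plane (a b c : R) :
  measurable [set p : mplane R | 0 < a * p.1 + b * p.2 + c].
Proof.
have m : measurable_fun setT ((fun p => a * p.1 + b * p.2 + c) : mplane R -> R).
  by apply: measurable_funD => //; apply: measurable_funD; apply: measurable_funM.
have := m measurableT _ (measurable_itv `]0, +oo[); rewrite setTI.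
by congr measurable; apply/seteqP; split=> p /=; rewrite in_itv/= andbT.
Qed.

Lemma controlled_face1 :
  controlled_near_face (1, 0, 0) (fun x => 1 * x.1.1 + 0 * x.1.2 + (- k1) * x.2 + 0).
Proof.
apply: (@control_of_line (plane1 k1) (1, 0, 0) 1 0 (- k1) 0
  [set p | p.1 > k2 * p.2 /\ 0 < p.2 < 1] (fun z => (z.2 + k1 * z.1.2, z.1.1, z.1.2))).
- move=> p s; rewrite /plane1; congr (_, _, _) => /=; rewrite /GRing.scale/=; ring.
- apply: measurable_fun_pair; first apply: measurable_fun_pair.
  + apply: measurable_affine => //; exact: measurableT_comp.
  + exact: measurableT_comp.
  + exact: measurableT_comp.
- exact: measurable_plane1.
- by move=> F mF F0; exact: ge0_integral_leb3_line1.
- move=> p s e e1; rewrite /layer/=; split.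
    by move=> [[h1 h2 /andP[h3 h4]] h5]; repeat split; try apply/andP; try split; lra.
  by move=> [[h1 /andP[h2 h3]] /andP[h4 h5]]; repeat split; try apply/andP; try split; lra.
- by move=> p /=; ring.
- rewrite (_ : [set p | _] = [set p : mplane R | 0 < 1 * p.1 + (- k2) * p.2 + 0] `&`
      ([set p : mplane R | 0 < 0 * p.1 + 1 * p.2 + 0] `&`
       [set p : mplane R | 0 < 0 * p.1 + (-1) * p.2 + 1])).
    by apply: measurableI; last apply: measurableI; exact: measurable_half_plane.
  apply/seteqP; split=> p /=.
    by move=> [h1 /andP[h2 h3]]; repeat split; lra.
  by move=> [h1 [h2 h3]]; split; [lra|apply/andP; split; lra].
- by move=> B /planes_area_terms[].
Qed.

Lemma controlled_face2 :
  controlled_near_face (0, 1, 0) (fun x => 0 * x.1.1 + 1 * x.1.2 + (- k2) * x.2 + 0).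
Proof.
apply: (@control_of_line (plane2 k2) (0, 1, 0) 0 1 (- k2) 0
  [set p | p.1 > k1 * p.2 /\ 0 < p.2 < 1] (fun z => (z.1.1, z.2 + k2 * z.1.2, z.1.2))).
- move=> p s; rewrite /plane2; congr (_, _, _) => /=; rewrite /GRing.scale/=; ring.
- apply: measurable_fun_pair; first apply: measurable_fun_pair.
  + exact: measurableT_comp.
  + apply: measurable_affine => //; exact: measurableT_comp.
  + exact: measurableT_comp.
- exact: measurable_plane2.
- by move=> F mF F0; exact: ge0_integral_leb3_line2.
- move=> p s e e1; rewrite /layer/=; split.
    by move=> [[h1 h2 /andP[h3 h4]] h5]; repeat split; try apply/andP; try split; lra.
  by move=> [[h1 /andP[h2 h3]] /andP[h4 h5]]; repeat split; try apply/andP; try split; lra.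
- by move=> p /=; ring.
- rewrite (_ : [set p | _] = [set p : mplane R | 0 < 1 * p.1 + (- k1) * p.2 + 0] `&`
      ([set p : mplane R | 0 < 0 * p.1 + 1 * p.2 + 0] `&`
       [set p : mplane R | 0 < 0 * p.1 + (-1) * p.2 + 1])).
    by apply: measurableI; last apply: measurableI; exact: measurable_half_plane.
  apply/seteqP; split=> p /=.
    by move=> [h1 /andP[h2 h3]]; repeat split; lra.
  by move=> [h1 [h2 h3]]; split; [lra|apply/andP; split; lra].
- by move=> B /planes_area_terms[].
Qed.

Let measurable_line34 (a b : R) (h : mplane R * measurableTypeR R -> measurableTypeR R) :
  measurable_fun setT h -> measurable_fun setT
  ((fun z => (z.1.1 + a * z.2, z.1.2 + b * z.2, h z)) : mplane R * measurableTypeR R -> mspace R).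
Proof.
move=> mh; apply: measurable_fun_pair => //; apply: measurable_fun_pair.
- apply: measurable_affine => //; exact: measurableT_comp.
- apply: measurable_affine => //; exact: measurableT_comp.
Qed.

Lemma controlled_face3 :
  controlled_near_face (k1, k2, 1) (fun x => 0 * x.1.1 + 0 * x.1.2 + 1 * x.2 + 0).
Proof.
apply: (@control_of_line (@plane3 R) (k1, k2, 1) 0 0 1 0
  [set p | p.1 > 0 /\ p.2 > 0] (fun z => (z.1.1 + k1 * z.2, z.1.2 + k2 * z.2, z.2))).
- move=> p s; rewrite /plane3; congr (_, _, _) => /=; rewrite /GRing.scale/=; ring.
- exact: measurable_line34.
- exact: measurable_plane3.
- by move=> F mF F0; exact: ge0_integral_leb3_line3.
- move=> p s e e1; rewrite /layer/=; split.
    by move=> [[h1 h2 /andP[h3 h4]] h5]; repeat split; try apply/andP; try split; lra.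
  by move=> [[h1 h2] /andP[h4 h5]]; repeat split; try apply/andP; try split; lra.
- by move=> p /=; ring.
- rewrite (_ : [set p | _] = [set p : mplane R | 0 < 1 * p.1 + 0 * p.2 + 0] `&`
      [set p : mplane R | 0 < 0 * p.1 + 1 * p.2 + 0]).
    by apply: measurableI; exact: measurable_half_plane.
  by apply/seteqP; split=> p /= -[h1 h2]; split; lra.
- by move=> B /planes_area_terms[].
Qed.

Lemma controlled_face4 :
  controlled_near_face (- k1, - k2, -1) (fun x => 0 * x.1.1 + 0 * x.1.2 + (-1) * x.2 + 1).
Proof.
apply: (@control_of_line (@plane4 R) (- k1, - k2, -1) 0 0 (-1) 1
  [set p | p.1 > k1 /\ p.2 > k2]
  (fun z => (z.1.1 + (- k1) * z.2, z.1.2 + (- k2) * z.2, 1 - z.2))).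
- move=> p s; rewrite /plane4; congr (_, _, _) => /=; rewrite /GRing.scale/=; ring.
- by apply: measurable_line34; apply: measurable_funB.
- exact: measurable_plane4.
- by move=> F mF F0; exact: ge0_integral_leb3_line4.
- move=> p s e e1; rewrite /layer/=; split.
    by move=> [[h1 h2 /andP[h3 h4]] h5]; repeat split; try apply/andP; try split; lra.
  by move=> [[h1 h2] /andP[h4 h5]]; repeat split; try apply/andP; try split; lra.
- by move=> p /=; ring.
- rewrite (_ : [set p | _] = [set p : mplane R | 0 < 1 * p.1 + 0 * p.2 + (- k1)] `&`
      [set p : mplane R | 0 < 0 * p.1 + 1 * p.2 + (- k2)]).
    by apply: measurableI; exact: measurable_half_plane.
  by apply/seteqP; split=> p /= -[h1 h2]; split; lra.
- by move=> B /planes_area_terms[].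
Qed.

End faces.

(** * Smooth cutoffs *)

Section cutoff.
Variable R : realType.
Local Notation cd := (@continuously_differentiable R).
Local Notation F := (flat (1 : {poly R})).
Local Notation dF := (flat ('X ^+ 2 * (1 - (1 : {poly R})^`()))).

Lemma flat1_ge0 x : 0 <= F x.
Proof. by rewrite /flat; case: ifP => // _; rewrite hornerC mul1r expR_ge0. Qed.

Lemma flat1_gt0 x : 0 < x -> 0 < F x.
Proof. by move=> x0; rewrite flat_gt0// hornerC mul1r expR_gt0. Qed.

Lemma flat1_le x y : x <= y -> F x <= F y.
Proof.
move=> xy; have [x0|x0] := ltP 0 x; last by rewrite flat_le0// flat1_ge0.
have y0 : 0 < y by exact: lt_le_trans xy.
rewrite !flat_gt0// !hornerC !mul1r ler_expR lerN2 lef_pV2//.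
Qed.

Let c := F (1 / 2).

Let c0 : 0 < c. Proof. by apply: flat1_gt0; rewrite divr_gt0. Qed.

(** [F (1 - r)] decreases, is at least [c] for $r \leq 1/2$ and vanishes for
    $r \geq 1$; thus [cut] increases from zero on the first half-line to one on the
    second. *)
Definition cut (r : R) := F (c - F (1 - r)) / F c.
Definition dcut (r : R) := dF (c - F (1 - r)) * dF (1 - r) / F c.

Let Fc0 : 0 < F c. Proof. exact: flat1_gt0. Qed.

Lemma cut_ge0 r : 0 <= cut r.
Proof. by rewrite /cut divr_ge0 ?flat1_ge0. Qed.

Lemma cut_le1 r : cut r <= 1.
Proof. by rewrite /cut ler_pdivrMr// mul1r flat1_le// lerBlDr lerDl flat1_ge0. Qed.

Lemma cut_eq0 r : r <= 1 / 2 -> cut r = 0.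
Proof.
move=> r2; rewrite /cut flat_le0 ?mul0r// subr_le0; apply: flat1_le; lra.
Qed.

Lemma cut_eq1 r : 1 <= r -> cut r = 1.
Proof. by move=> r1; rewrite /cut (flat_le0 _ (x := 1 - r)) ?subr_le0// subr0 divff// gt_eqF. Qed.

Lemma dcut_eq0 r : 1 <= r -> dcut r = 0.
Proof. by move=> r1; rewrite /dcut [dF (1 - r)]flat_le0 ?subr_le0// mulr0 mul0r. Qed.

Lemma dcut_bounded : exists2 M : R, 0 <= M & forall r, `|dcut r| <= M.
Proof.
have [C C0 CP] := flat_bounded ('X ^+ 2 * (1 - (1 : {poly R})^`())).
exists (C * C / F c); first by rewrite divr_ge0 ?mulr_ge0 ?flat1_ge0.
move=> r; rewrite /dcut normrM [X in _ * X]ger0_norm ?invr_ge0 ?flat1_ge0//.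
by rewrite ler_wpM2r ?invr_ge0 ?flat1_ge0// normrM ler_pM.
Qed.

Lemma cd_cut n (g : space R -> R) : cd n g -> cd n (fun x => cut (g x)).
Proof.
move=> cg; rewrite /cut; apply: cdM; last exact: cd_cst.
apply: cd_flat; apply: cdB; first exact: cd_cst.
by apply: cd_flat; apply: cdB => //; exact: cd_cst.
Qed.

Lemma is_derive_cut (r : R) : is_derive r 1 cut (dcut r).
Proof.
have d1 : is_derive r 1 (fun r : R => 1 - r) (- 1).
  rewrite -[- 1]sub0r.
  exact: (is_deriveB (is_derive_cst (1 : R) r 1) (is_derive_id r 1)).
have d2 : is_derive r 1 (fun r : R => F (1 - r)) (dF (1 - r) * - 1).
  exact: (@is_derive_comp_line _ _ F (fun r : R => 1 - r) r 1 _ _ (is_derive_flat 1 _) d1).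
have d3 : is_derive r 1 (fun r : R => c - F (1 - r)) (dF (1 - r)).
  rewrite -[dF (1 - r)]opprK -[- dF _]mulrN1 -[X in is_derive _ _ _ X]sub0r.
  exact: (is_deriveB (is_derive_cst c r 1) d2).
have d4 := @is_derive_comp_line _ _ F (fun r : R => c - F (1 - r)) r 1 _ _
  (is_derive_flat 1 _) d3.
have -> : cut = (fun r : R => (F c)^-1 *: F (c - F (1 - r))).
  by apply/funext => s; rewrite /cut mulrC.
rewrite (_ : dcut r = (F c)^-1 *: (dF (c - F (1 - r)) * dF (1 - r))); last first.
  by rewrite /dcut mulrC.
exact: is_deriveZ.
Qed.

End cutoff.

(** * Extension by zero *)

Section restriction.
Variable R : realType.
Local Notation L3 := (leb3 : {measure set (mspace R) -> \bar R}).
Local Notation N f := (ip L3 f f).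
Implicit Types (S O : set (mspace R)) (f g : space R -> R).

Definition rst S f : space R -> R := fun x => (\1_S : mspace R -> R) x * f x.

Lemma rst_in S f x : S x -> rst S f x = f x.
Proof. by move=> Sx; rewrite /rst indicE mem_set// mul1r. Qed.

Lemma rst_out S f x : ~ S x -> rst S f x = 0.
Proof. by move=> Sx; rewrite /rst indicE memNset// mul0r. Qed.

Lemma sqi_rst S f : measurable S -> sqi L3 f -> sqi L3 (rst S f).
Proof.
move=> mS; apply: (@sqiM _ _ _ _ 1); first exact: measurable_indic.
by move=> x; rewrite indicE; case: (_ \in _); rewrite ?normr1 ?normr0.
Qed.

Lemma ip_rst S f : measurable S -> sqi L3 f ->
  (\int[leb3]_(x in S) (f x ^+ 2)%:E)%E = (N (rst S f))%:E.
Proof.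
move=> mS sf; rewrite -ip_sqr; last exact: sqi_rst.
rewrite [LHS]integral_mkcond; apply: eq_integral => x _; rewrite patchE /rst indicE.
by case: (_ \in _); rewrite ?mul1r// mul0r expr0n.
Qed.

Lemma ip_rst_le S f : measurable S -> sqi L3 f -> N (rst S f) <= N f.
Proof.
move=> mS sf; apply: le_ip => //; first exact: sqi_rst.
move=> x; rewrite /rst indicE; case: (_ \in _); rewrite ?mul1r// mul0r expr0n/=.
exact: sqr_ge0.
Qed.

Lemma sqi_ddir (a b c : R) (w : 'I_3 -> space R -> R) :
  (forall i, sqi L3 (w i)) -> sqi L3 (ddir a b c w).
Proof.
by move=> sw; apply: sqiD; [apply: sqiD|]; exact: sqiZ.
Qed.

Lemma ipZZ (a : R) f : sqi L3 f -> N (fun x => a * f x) = a ^+ 2 * N f.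
Proof.
move=> sf; rewrite ipZl//; last exact: sqiZ.
by rewrite ipC ipZl//; ring.
Qed.

Lemma ip_ddir_le (a b c e : R) (w : 'I_3 -> space R -> R) :
  (forall i, sqi L3 (w i)) -> (forall i, N (w i) <= e) ->
  N (ddir a b c w) <= (a ^+ 2 *+ 4 + b ^+ 2 *+ 4 + c ^+ 2 *+ 2) * e.
Proof.
move=> sw we.
have s i d := sqiZ d (sw i).
have h1 := ipD_le (sqiD (s 0 a) (s 1 b)) (s 2%:R c).
have h2 := ipD_le (s 0 a) (s 1 b).
rewrite !ipZZ// in h1 h2.
have g (d : R) i : d ^+ 2 * N (w i) <= d ^+ 2 * e by rewrite ler_wpM2l// sqr_ge0.
move: (g a 0) (g b 1) (g c 2%:R) => g0 g1 g2.
by apply: (le_trans h1); lra.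
Qed.

Lemma rst_ddir_sub S O (a b c : R) (g w : 'I_3 -> space R -> R) x : S `<=` O ->
  rst S (ddir a b c g) x = rst S (ddir a b c w) x -
    rst S (ddir a b c (fun i x => w i x - rst O (g i) x)) x.
Proof.
move=> SO; have [Sx|Sx] := pselect (S x); last by rewrite !rst_out// subr0.
have Ox := SO _ Sx.
have E (p q r u v s : R) : a * p + b * q + c * r =
  a * u + b * v + c * s - (a * (u - p) + b * (v - q) + c * (s - r)) by ring.
rewrite (rst_in (ddir a b c g) Sx) (rst_in (ddir a b c w) Sx) (rst_in _ Sx) /ddir.
by rewrite (rst_in (g 0) Ox) (rst_in (g 1) Ox) (rst_in (g 2%:R) Ox); exact: E.
Qed.

(** Dominated convergence: the restrictions tend to zero at every point. *)
Lemma ip_rst_cvg0 (S : nat -> set (mspace R)) f : (forall n, measurable (S n)) ->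
  sqi L3 f -> (forall x, \forall n \near \oo, ~ S n x) ->
  (fun n => N (rst (S n) f)) @ \oo --> (0 : R).
Proof.
move=> mS sf S0.
have m_ n : measurable_fun setT (fun x : mspace R => (rst (S n) f x ^+ 2)%:E).
  apply/measurable_EFinP; apply: measurable_funX.
  by case: (sqi_rst (mS n) sf).
have H : (\int[leb3]_x (rst (S n) f x ^+ 2)%:E @[n --> \oo] --> \int[L3]_x (cst 0 x))%E.
  apply: (@dominated_cvg _ _ _ L3 setT measurableT
    (fun n (x : mspace R) => (rst (S n) f x ^+ 2)%:E) (cst 0%E)
    (fun x : mspace R => (f x ^+ 2)%:E) m_).
  - move=> x _; apply: cvg_near_cst.
    by apply: filterS (S0 x) => n nS; rewrite rst_out// expr0n.
  - by [].
  - exact: (sqi_integrable sf).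
  - move=> n x _; rewrite /= lee_fin ger0_norm ?sqr_ge0// /rst indicE.
    by case: (_ \in _); rewrite ?mul1r// mul0r expr0n/= sqr_ge0.
rewrite integral0 in H.
suff -> : (fun n => N (rst (S n) f)) =
    fine \o (fun n => \int[leb3]_x (rst (S n) f x ^+ 2)%:E)%E by exact: fine_cvg.
by apply/funext => n /=; rewrite (ip_sqr (sqi_rst (mS n) sf)).
Qed.

End restriction.

(** * Zero trace and approximation by test functions in the layer *)

Lemma strip_arith (R : realType) (s x y z r e2 er C eta : R) :
  s <= x *+ 2 + r *+ 2 -> x <= 2 * er + 2 * e2 * y ->
  e2 * y <= e2 * (z *+ 2 + (C * r) *+ 2) -> r * 6 + r * (8 * C) = eta ->
  e2 * (C * r) <= C * r -> er <= r -> s <= 8 * e2 * z + eta.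
Proof. by move=> *; lra. Qed.

Section cutoff_arith.
Variable R : realType.
Implicit Types K E eta n d : R.

Lemma cutoff_arith1 K E eta n : 0 <= K -> 0 < E -> 0 < eta ->
  n <= eta * E / (16 * (K + 1)) -> K / E * n <= eta / 16.
Proof.
move=> K0 E0 eta0; rewrite ler_pdivlMr; last by rewrite mulr_gt0// ltr_wpDl.
by move=> h; rewrite mulrAC ler_pdivrMr//; nra.
Qed.

Lemma cutoff_arith2 K E eta n d : 0 <= K -> 0 < E -> 0 < eta -> 0 <= d ->
  n <= 8 * E * d -> d < eta / (32 * (K + 1) * 8) -> K / E * n <= eta / 32.
Proof.
move=> K0 E0 eta0 d0 nd; rewrite ltr_pdivlMr; last by rewrite !mulr_gt0// ltr_wpDl.
move=> h; rewrite mulrAC ler_pdivrMr//.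
have h1 : K * n <= K * (8 * E * d) by rewrite ler_wpM2l.
have h2 : K * d <= (K + 1) * d by rewrite ler_wpM2r// lerDl.
have h3 : E * (K * d * 8) <= E * (eta / 32).
  by rewrite ler_wpM2l ?(ltW E0)//; lra.
by apply: (le_trans h1); lra.
Qed.

Lemma cutoff_arith3 eta r A a B b : A <= a -> a < eta / 8 -> B <= b -> b < r ->
  r <= eta / 16 -> 0 < eta -> A *+ 2 + B *+ 2 < eta.
Proof. by move=> *; lra. Qed.

Lemma cutoff_arith4 eta r S1 S2 X x Y y Z W : S1 <= X *+ 2 + Y *+ 2 ->
  S2 <= Z *+ 2 + W *+ 2 -> X <= x -> x < eta / 16 -> Y <= y -> y < r -> r <= eta / 16 ->
  Z <= eta / 16 -> W <= eta / 32 -> 0 < eta -> S1 *+ 2 + S2 *+ 2 < eta.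
Proof. by move=> *; lra. Qed.

End cutoff_arith.

Section zero_trace.
Variables (R : realType) (k1 k2 : R).
Local Notation L3 := (leb3 : {measure set (mspace R) -> \bar R}).
Local Notation N f := (ip L3 f f).
Local Notation Om := (layer k1 k2 : set (mspace R)).
Local Notation area := (planes_area k1 k2 : {measure set (mspace R) -> \bar R}).
Variables (a : space R -> R) (w : 'I_3 -> space R -> R).
Hypotheses (sa : sqi L3 a) (sw : forall i, sqi L3 (w i)).
Hypotheses (a0 : forall x, ~ Om x -> a x = 0) (w0 : forall i x, ~ Om x -> w i x = 0).

(** Here [a] and [w] are extended by zero outside the layer while [phi] lives on the
    whole space: the restriction of [phi] makes the comparison one on the layer
    alone. *)
Definition approximable (O : set (space R)) := forall e, 0 < e ->
  exists phi, [/\ rtest O phi, N (fun x => a x - rst Om phi x) < e &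
    forall i, N (fun x => w i x - rst Om (rpartial i phi) x) < e].

Definition approximable_zero_trace := forall e, 0 < e ->
  exists phi, [/\ rtest setT phi, N (fun x => a x - rst Om phi x) < e,
    forall i, N (fun x => w i x - rst Om (rpartial i phi) x) < e &
    (\int[area]_(x in boundary (layer k1 k2)) (phi x ^+ 2)%:E < e%:E)%E].

Let mOm : measurable Om. Proof. exact: measurable_layer. Qed.

(** In the limit the face does not contribute to [controlled_near_face], and the mass
    in the strip is of order $e^2$. The factor $8$ is the $2$ found there, doubled
    each time that a function is compared with its approximation. *)
Lemma strip_le_zero_trace (k : R * R * R) (ell : space R -> R) (e : R) :
  measurable (strip k1 k2 ell e) ->
  controlled_near_face k1 k2 k ell -> approximable_zero_trace -> 0 < e -> e <= 1 ->
  N (rst (strip k1 k2 ell e) a) <=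
  8 * e ^+ 2 * N (rst (strip k1 k2 ell e) (ddir k.1.1 k.1.2 k.2 w)).
Proof.
move=> mS ctl ztr e0 e1; set S := strip _ _ _ _ in mS *.
pose C := k.1.1 ^+ 2 *+ 4 + k.1.2 ^+ 2 *+ 4 + k.2 ^+ 2 *+ 2.
have C0 : 0 <= C.
  by rewrite /C; have := sqr_ge0 k.1.1; have := sqr_ge0 k.1.2; have := sqr_ge0 k.2; lra.
have SO : S `<=` Om by move=> x [].
set dw := ddir _ _ _ w.
have sdw : sqi L3 dw by exact: sqi_ddir.
apply/ler_addgt0Pr => eta eta0.
pose r := eta / (6 + 8 * C).
have D0 : 0 < 6 + 8 * C by lra.
have r0 : 0 < r by rewrite divr_gt0.
have [phi [tphi ha hw hb]] := ztr r r0.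
have sphi := rtest_sqi tphi.
have sd i := rtest_sqi (rtest_partial i tphi).
set dp := ddir k.1.1 k.1.2 k.2 (fun i => rpartial i phi).
have sdp : sqi L3 dp by exact: sqi_ddir.
have H1 : N (rst S a) <= N (rst S phi) *+ 2 + r *+ 2.
  have -> : rst S a = (fun x => rst S phi x + rst S (fun x => a x - rst Om phi x) x).
    apply/funext => x; have [Sx|Sx] := pselect (S x); last by rewrite !rst_out// addr0.
    rewrite (rst_in a Sx) (rst_in phi Sx) (rst_in _ Sx) (rst_in _ (SO _ Sx)); ring.
  have s1 : sqi L3 (fun x => a x - rst Om phi x) by apply: sqiB => //; exact: sqi_rst.
  apply: (le_trans (ipD_le (sqi_rst mS sphi) (sqi_rst mS s1))).
  rewrite lerD2l lerMn2r/=; apply: le_trans (ltW ha); exact: ip_rst_le.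
have H2 : N (rst S phi) <= 2 * e * r + 2 * e ^+ 2 * N (rst S dp).
  have := ctl phi e tphi e0 e1; rewrite -/S -/dp !ip_rst// => h.
  have h' : ((2 * e)%:E * \int[area]_(x in boundary (layer k1 k2)) (phi x ^+ 2)%:E <=
      (2 * e)%:E * r%:E)%E.
    by apply: lee_wpmul2l; [rewrite lee_fin mulr_ge0// ltW|exact: ltW hb].
  rewrite -lee_fin; apply: (le_trans h); rewrite EFinD [(2 * e * r)%:E]EFinM.
  by rewrite [(2 * e ^+ 2 * _)%:E]EFinM; exact: leeD.
have H3 : N (rst S dp) <= N (rst S dw) *+ 2 + (C * r) *+ 2.
  have s1 i : sqi L3 (fun x => w i x - rst Om (rpartial i phi) x).
    by apply: sqiB => //; exact: sqi_rst.
  have s2 := sqi_ddir k.1.1 k.1.2 k.2 s1.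
  have -> : rst S dp = (fun x => rst S dw x -
      rst S (ddir k.1.1 k.1.2 k.2 (fun i x => w i x - rst Om (rpartial i phi) x)) x).
    by apply/funext => x; exact: rst_ddir_sub.
  apply: (le_trans (ipB_le (sqi_rst mS sdw) (sqi_rst mS s2))).
  rewrite lerD2l lerMn2r/=; apply: (le_trans (ip_rst_le mS s2)).
  by apply: ip_ddir_le => // i; exact: ltW.
have rE : r * 6 + r * (8 * C) = eta by rewrite -mulrDr /r divfK// gt_eqF.
have p1 : 0 <= N (rst S dw) by exact: ip_ge0.
have Cr : 0 <= C * r by rewrite mulr_ge0// ltW.
have e2 : e ^+ 2 <= 1 by rewrite expr_le1// ltW.
have e20 : 0 <= e ^+ 2 by exact: sqr_ge0.
have H4 : e ^+ 2 * N (rst S dp) <= e ^+ 2 * (N (rst S dw) *+ 2 + (C * r) *+ 2).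
  by rewrite ler_wpM2l.
have H5 : e ^+ 2 * (C * r) <= C * r by rewrite ler_piMl.
have H6 : e * r <= r by rewrite ler_piMl// ltW.
move: H2; rewrite -(mulrA 2 e r) => H2.
exact: strip_arith H1 H2 H4 rE H5 H6.
Qed.

(** The approximation is multiplied by a function of [ell / e] that vanishes near the
    face. The derivative of this factor is of order $1/e$ and lives in the strip,
    where by [strip_le_zero_trace] the squared mass of [a] is at most $8 e^2$ times
    that of a square integrable function in a shrinking set; so the error tends to
    zero with $e$. *)
Lemma approximable_off_face (O : set (space R)) (k : R * R * R) (b1 b2 b3 h : R) :
  let ell := fun x : space R => b1 * x.1.1 + b2 * x.1.2 + b3 * x.2 + h in
  (forall x, Om x -> 0 < ell x) -> controlled_near_face k1 k2 k ell ->
  approximable_zero_trace -> approximable O ->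
  approximable (O `&` [set x | 0 < ell x]).
Proof.
move=> ell ell0 ctl ztr apx eta eta0.
have [M M0 MP] := @dcut_bounded R.
have mS e : measurable (strip k1 k2 ell e : set (mspace R)).
  by apply: open_measurable_space; exact: open_strip.
pose S n := strip k1 k2 ell n.+1%:R^-1.
have S0 x : \forall n \near \oo, ~ S n x.
  have [Ox|nOx] := pselect (Om x); last by near=> n; case.
  have lx := ell0 x Ox.
  near=> n; move=> [_]; apply/negP; rewrite -leNgt ltW//.
  by near: n; exact: near_infty_natSinv_lt (PosNum lx).
pose L := `|b1| + `|b2| + `|b3|.
have L0 : 0 <= L by rewrite /L !addr_ge0.
have := ip_rst_cvg0 (fun n => mS _) (sqi_ddir k.1.1 k.1.2 k.2 sw) S0.
set dw := ddir _ _ _ w => Sdw.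
pose K := (M * L) ^+ 2.
have K0 : 0 <= K by exact: sqr_ge0.
have sdw : sqi L3 dw by exact: sqi_ddir.
have nb (g : space R -> R) (r : R) : (fun n => N (rst (S n) g)) @ \oo --> (0 : R) -> 0 < r ->
    \forall n \near \oo, N (rst (S n) g) < r.
  move=> cg r0; have /cvgr0Pnorm_lt/(_ r r0) := cg.
  by apply: filterS => n; apply: le_lt_trans; exact: ler_norm.
have e2 : 0 < eta / 8 by rewrite divr_gt0.
have e3 : 0 < eta / (32 * (K + 1) * 8) by rewrite divr_gt0// !mulr_gt0// ltr_wpDl.
have : exists n, [/\ N (rst (S n) a) < eta / 8, forall i, N (rst (S n) (w i)) < eta / 16 &
     N (rst (S n) dw) < eta / (32 * (K + 1) * 8)].
  have e4 : 0 < eta / 16 by rewrite divr_gt0.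
  have na := nb _ _ (ip_rst_cvg0 (fun n => mS _) sa S0) e2.
  have nw i := nb _ _ (ip_rst_cvg0 (fun n => mS _) (sw i) S0) e4.
  have nd := nb _ _ Sdw e3.
  have nw' : \forall n \near \oo, forall i, N (rst (S n) (w i)) < eta / 16.
    exact: filter_forall.
  have [n _ /(_ n (leqnn n)) [[h1 h2] h3]] := filterI (filterI na nw') nd.
  by exists n.
move=> [n [ha hw hd]].
pose e : R := n.+1%:R^-1.
have e0 : 0 < e by rewrite invr_gt0.
have e1 : e <= 1 by rewrite invf_le1// ler1n.
pose chi (x : space R) := cut (ell x / e).
have ellE : (fun x => ell x / e) = (fun x : space R =>
    (b1 / e) * x.1.1 + (b2 / e) * x.1.2 + (b3 / e) * x.2 + h / e).
  by apply/funext => x; rewrite /ell; ring.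
have schi m : continuously_differentiable m chi.
  by rewrite /chi; apply: cd_cut; rewrite ellE; exact: cd_affine.
pose dchi i x := dcut (ell x / e) *
  ((b1 / e) * (dir R i).1.1 + (b2 / e) * (dir R i).1.2 + (b3 / e) * (dir R i).2).
have dchiP i x : is_derive x (dir R i) chi (dchi i x).
  apply: is_derive_comp_line; first exact: is_derive_cut.
  rewrite ellE; exact: is_derive_affine.
have dchi_le i x : `|dchi i x| <= M * L / e.
  rewrite /dchi normrM -[leRHS]mulrA ler_pM//.
  rewrite (_ : b1 / e * _ + _ + _ =
    (b1 * (dir R i).1.1 + b2 * (dir R i).1.2 + b3 * (dir R i).2) / e); last ring.
  rewrite normrM [X in _ * X]ger0_norm ?invr_ge0 ?(ltW e0)//.
  rewrite ler_wpM2r ?invr_ge0 ?(ltW e0)//.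
  have d01 (j : nat) : `|((i == j :> nat)%N%:R : R)| <= 1.
    by case: (_ == _); rewrite ?normr1// normr0.
  apply: (le_trans (ler_normD _ _)); apply: lerD; last first.
    by rewrite normrM ler_piMr// d01.
  apply: (le_trans (ler_normD _ _)); apply: lerD; by rewrite normrM ler_piMr// d01.
have out x : Om x -> ~ S n x -> 1 <= ell x / e.
  move=> Ox nSx; rewrite ler_pdivlMr// mul1r leNgt; apply/negP => h'; exact: nSx.
pose r := Order.min (eta / 16) (eta * e ^+ 2 / (16 * (K + 1))).
have r0 : 0 < r.
  by rewrite lt_min !divr_gt0 ?mulr_gt0 ?exprn_gt0// ltr_wpDl.
have r1 : r <= eta / 16 by rewrite ge_min lexx.
have r2 : r <= eta * e ^+ 2 / (16 * (K + 1)) by rewrite ge_min lexx orbT.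
have [phi [tphi pa pw]] := apx r r0.
have sphi := rtest_sqi tphi.
have sd i := rtest_sqi (rtest_partial i tphi).
have mchi : measurable_fun setT (chi : mspace R -> R).
  by apply: continuous_measurable_space; exact: (cd_continuous (schi 0%N)).
have mdchi i : measurable_fun setT (dchi i : mspace R -> R).
  rewrite (_ : dchi i = rpartial i chi); last first.
    by apply/funext => x; rewrite (rpartialE (dchiP i x)).
  by apply: continuous_measurable_space; exact: (cd_continuous (cd_partial i (schi 1%N))).
have chi01 x : `|chi x| <= 1 by rewrite ger0_norm ?cut_ge0// cut_le1.
have tchi : rtest (O `&` [set x | 0 < ell x]) (fun x => chi x * phi x).
  apply: (rtestM (A := [set x | e / 2 <= ell x]) tphi schi).
  - rewrite (_ : [set x | _] = ~` [set x : space R |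
      0 < (- b1) * x.1.1 + (- b2) * x.1.2 + (- b3) * x.2 + (e / 2 - h)]).
      by apply: open_closedC; exact: open_affine.
    apply/seteqP; split=> x /=; rewrite /ell => hx; [apply/negP|]; rewrite -?leNgt.
      by clear -hx; lra.
    by move/negP : hx; rewrite -leNgt => hx; clear -hx; lra.
  - move=> x; apply: contraNP => /negP; rewrite -ltNge => h'; rewrite /chi cut_eq0//.
    by rewrite ler_pdivrMr// mulrC; clear -h'; lra.
  - by move=> x [Ox /= h']; split => //=; clear -h' e0; lra.
have dprod i x : rpartial i (fun x => chi x * phi x) x =
    chi x * rpartial i phi x + phi x * dchi i x.
  apply: rpartialE.
  exact: (is_deriveM (dchiP i x) (cd_is_derive i x (rtest_cd 1 tphi))).
have s1 : sqi L3 (fun x => a x - rst Om phi x) by apply: sqiB => //; exact: sqi_rst.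
have s2 i : sqi L3 (fun x => w i x - rst Om (rpartial i phi) x).
  by apply: sqiB => //; exact: sqi_rst.
have mSn := mS e; rewrite -/(S n) in mSn.
have m1chi : measurable_fun setT ((fun x => 1 - chi x) : mspace R -> R).
  exact: measurable_funB.
have one_chi x : `|1 - chi x| <= 1.
  by rewrite ger0_norm ?subr_ge0 ?cut_le1// gerBl cut_ge0.
have cut_rst (g : space R -> R) : (forall x, ~ Om x -> g x = 0) -> sqi L3 g ->
    N (fun x => (1 - chi x) * g x) <= N (rst (S n) g).
  move=> g0 sg; apply: le_ip; [exact: (sqiM m1chi one_chi)|exact: sqi_rst|].
  move=> x; have [Sx|Sx] := pselect (S n x).
    rewrite rst_in// exprMn ler_piMl ?sqr_ge0//.
    by rewrite -(real_normK (num_real (1 - chi x))) expr_le1.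
  rewrite rst_out//; have [Ox|nOx] := pselect (Om x).
    by rewrite /chi cut_eq1 ?subrr ?mul0r//; exact: out.
  by rewrite g0// mulr0.
have chi_N g : sqi L3 g -> N (fun x => chi x * g x) <= N g.
  move=> sg; apply: le_ip => //; first exact: (sqiM mchi chi01).
  move=> x; rewrite exprMn ler_piMl ?sqr_ge0//.
  by rewrite -(real_normK (num_real (chi x))) expr_le1.
have dchi_N i g : sqi L3 g -> N (fun x => dchi i x * g x) <= K / e ^+ 2 * N g.
  move=> sg; rewrite (_ : K / e ^+ 2 = (M * L / e) ^+ 2); last first.
    by rewrite /K; rewrite -expr_div_n.
  rewrite -ipZZ//; apply: le_ip; [exact: (sqiM (mdchi i) (dchi_le i))|exact: sqiZ|].
  move=> x; rewrite [leLHS]exprMn [leRHS]exprMn; apply: ler_wpM2r; first exact: sqr_ge0.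
  rewrite -(real_normK (num_real (dchi i x))); apply: lerXn2r; rewrite ?nnegrE//.
  by rewrite !mulr_ge0// invr_ge0 ltW.
have dchi_rst i : (fun x => dchi i x * a x) = (fun x => dchi i x * rst (S n) a x).
  apply/funext => x; have [Sx|Sx] := pselect (S n x); first by rewrite rst_in.
  rewrite rst_out//; have [Ox|nOx] := pselect (Om x).
    by rewrite /dchi dcut_eq0 ?mul0r//; exact: out.
  by rewrite a0.
exists (fun x => chi x * phi x); split => //.
  have -> : (fun x => a x - rst Om (fun x => chi x * phi x) x) =
      (fun x => (1 - chi x) * a x + chi x * (a x - rst Om phi x)).
    apply/funext => x; have [Ox|nOx] := pselect (Om x).
      by rewrite !rst_in//; ring.
    by rewrite !rst_out// a0//; ring.
  apply: (le_lt_trans (ipD_le (sqiM m1chi one_chi sa) (sqiM mchi chi01 s1))).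
  exact: cutoff_arith3 (cut_rst a a0 sa) ha (chi_N _ s1) pa r1 eta0.
move=> i.
have -> : (fun x => w i x - rst Om (rpartial i (fun x => chi x * phi x)) x) =
    (fun x => ((1 - chi x) * w i x + chi x * (w i x - rst Om (rpartial i phi) x)) +
      (dchi i x * (a x - rst Om phi x) - dchi i x * rst (S n) a x)).
  apply/funext => x; rewrite -[dchi i x * rst _ _ _]/((fun x => dchi i x * rst (S n) a x) x).
  rewrite -dchi_rst; have [Ox|nOx] := pselect (Om x).
    by rewrite !rst_in// dprod; ring.
  by rewrite !rst_out// a0// w0//; ring.
have sSa := sqi_rst mSn sa.
have g1 := ipD_le (sqiD (sqiM m1chi one_chi (sw i)) (sqiM mchi chi01 (s2 i)))
  (sqiB (sqiM (mdchi i) (dchi_le i) s1) (sqiM (mdchi i) (dchi_le i) sSa)).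
have g2 := ipD_le (sqiM m1chi one_chi (sw i)) (sqiM mchi chi01 (s2 i)).
have g3 := ipB_le (sqiM (mdchi i) (dchi_le i) s1) (sqiM (mdchi i) (dchi_le i) sSa).
apply: (le_lt_trans g1).
have h1 := cut_rst _ (w0 i) (sw i).
have h2 := chi_N _ (s2 i).
have h3 := dchi_N i _ s1.
have h4 := dchi_N i _ sSa.
have h5 := strip_le_zero_trace mSn ctl ztr e0 e1.
have ep : 0 < e ^+ 2 by rewrite exprn_gt0.
have h6 := cutoff_arith1 K0 ep eta0 (le_trans (ltW pa) r2).
have h7 := cutoff_arith2 K0 ep eta0 (ip_ge0 _ _) h5 hd.
exact: cutoff_arith4 g2 g3 h1 (hw i) h2 (pw i) r1 (le_trans h3 h6) (le_trans h4 h7) eta0.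
Unshelve. all: by end_near. Qed.

(** One face after the other: the approximation obtained at one face is the starting
    point at the next, while the estimates in the strips always use the
    approximations with small boundary values. *)
Lemma approximable_layer : approximable_zero_trace -> approximable (layer k1 k2).
Proof.
move=> ztr.
have aT : approximable setT.
  by move=> e e0; have [phi [? ? ? _]] := ztr e e0; exists phi.
have p1 x : Om x -> 0 < 1 * x.1.1 + 0 * x.1.2 + (- k1) * x.2 + 0.
  by move=> [h1 h2 /andP[h3 h4]]; lra.
have p2 x : Om x -> 0 < 0 * x.1.1 + 1 * x.1.2 + (- k2) * x.2 + 0.
  by move=> [h1 h2 /andP[h3 h4]]; lra.
have p3 x : Om x -> 0 < 0 * x.1.1 + 0 * x.1.2 + 1 * x.2 + 0.
  by move=> [h1 h2 /andP[h3 h4]]; lra.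
have p4 x : Om x -> 0 < 0 * x.1.1 + 0 * x.1.2 + (-1) * x.2 + 1.
  by move=> [h1 h2 /andP[h3 h4]]; lra.
have a1 := approximable_off_face p1 (@controlled_face1 R k1 k2) ztr aT.
have a2 := approximable_off_face p2 (@controlled_face2 R k1 k2) ztr a1.
have a3 := approximable_off_face p3 (@controlled_face3 R k1 k2) ztr a2.
have a4 := approximable_off_face p4 (@controlled_face4 R k1 k2) ztr a3.
move=> e e0; have [phi [tphi ha hw]] := a4 e e0; exists phi; split => //.
have [sphi [K cK [phiK KO]]] := tphi; split => //; exists K => //; split => // x.
move=> /KO[[[[_ /= h1] /= h2] /= h3] /= h4].
by split; [lra|lra|apply/andP; split; lra].
Qed.

End zero_trace.

(** * Vanishing of real solutions *)

Lemma arith_quarter (R : realType) (a b c e : R) :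
  c <= a *+ 2 + b *+ 2 -> a < e / 4 -> b < e / 4 -> c < e.
Proof. by move=> *; lra. Qed.

Lemma arith_sixteenth (R : realType) (x y c : R) : x <= y -> y <= 1 / 16 * c -> x *+ 4 <= c / 4.
Proof. by move=> *; lra. Qed.

Lemma le_pinv_pow (R : realType) (c x : R) : 0 <= c -> (forall n, x <= c / 4 ^+ n) -> x <= 0.
Proof.
move=> c0 H; have h n : x <= c / n.+1%:R.
  apply: (le_trans (H n)); apply: ler_wpM2l => //; rewrite lef_pV2 ?posrE ?exprn_gt0//.
  elim: n => [|n IH]; first by rewrite expr0.
  rewrite exprS -natr1; have : (1 : R) <= n.+1%:R by rewrite ler1n.
  by move: IH; move: (4 ^+ n : R) (n.+1%:R : R) => a b; lra.
rewrite leNgt; apply/negP => x0.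
have [n _ /(_ n (leqnn n))] := near_infty_natSinv_lt (PosNum (divr_gt0 x0 (ltr_wpDl c0 ltr01))).
move=> /= hn; have := h n; rewrite leNgt => /negP; apply.
apply: (@le_lt_trans _ _ ((c + 1) * n.+1%:R^-1)).
  by rewrite ler_wpM2r ?invr_ge0// lerDl.
by rewrite mulrC -ltr_pdivlMr// ltr_wpDl.
Qed.

Section translation_argument.
Variables (R : realType) (k1 k2 : R).
Local Notation L3 := (leb3 : {measure set (mspace R) -> \bar R}).
Local Notation N f := (ip L3 f f).
Local Notation Om := (layer k1 k2).
Implicit Types (f h phi : space R -> R) (g : 'I_3 -> space R -> R).
(* Unification would otherwise compare products by unfolding the integrals. *)
#[local] Opaque rpartial ip.

(** [f] is in the closure $H^1_0$ of the test functions of the layer and [g] is its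
    gradient, both extended by zero. *)
Definition h10 f g := [/\ sqi L3 f, forall i, sqi L3 (g i) & forall e, 0 < e ->
  exists phi, [/\ rtest Om phi, N (fun x => f x - phi x) < e &
    forall i, N (fun x => g i x - rpartial i phi x) < e]].

(** The bilinear form of $- \Delta - \mu$; gradients are carried along as separate
    arguments. *)
Definition form (mu : R) f g f' g' : R :=
  \sum_(i < 3) ip L3 (g i) (g' i) - mu * ip L3 f f'.

Definition weak_solution (mu : R) f g := forall phi, rtest Om phi ->
  form mu f g phi (fun i => rpartial i phi) = 0.

Lemma formC mu f g f' g' : form mu f g f' g' = form mu f' g' f g.
Proof. by rewrite /form ipC; congr (_ - _); apply: eq_bigr => i _; rewrite ipC. Qed.

Lemma formBl mu f1 g1 f2 g2 f g : sqi L3 f1 -> (forall i, sqi L3 (g1 i)) ->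
  sqi L3 f2 -> (forall i, sqi L3 (g2 i)) -> sqi L3 f -> (forall i, sqi L3 (g i)) ->
  form mu (fun x => f1 x - f2 x) (fun i x => g1 i x - g2 i x) f g =
  form mu f1 g1 f g - form mu f2 g2 f g.
Proof.
move=> s1 t1 s2 t2 s t; rewrite /form ipBl// mulrBr.
under eq_bigr do rewrite ipBl//.
by rewrite sumrB; ring.
Qed.

Lemma formBr mu f1 g1 f2 g2 f g : sqi L3 f1 -> (forall i, sqi L3 (g1 i)) ->
  sqi L3 f2 -> (forall i, sqi L3 (g2 i)) -> sqi L3 f -> (forall i, sqi L3 (g i)) ->
  form mu f g (fun x => f1 x - f2 x) (fun i x => g1 i x - g2 i x) =
  form mu f g f1 g1 - form mu f g f2 g2.
Proof. by move=> *; rewrite formC formBl// !(formC mu f g). Qed.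

Lemma ip_small f : sqi L3 f -> forall d, 0 < d ->
  exists2 e, 0 < e & forall h, sqi L3 h -> N h < e -> `|ip L3 f h| <= d.
Proof.
move=> sf d d0; have n0 : 0 < N f + 1 by rewrite ltr_wpDl// ip_ge0.
exists (d ^+ 2 / (N f + 1)); first by rewrite divr_gt0// exprn_gt0.
move=> h sh; rewrite ltr_pdivlMr// => hd.
rewrite -(ler_pXn2r (n := 2))// ?nnegrE ?(ltW d0)// real_normK ?num_real//.
apply: (le_trans (ip_cauchy sf sh)).
apply: le_trans (ltW hd); rewrite mulrC ler_wpM2l ?ip_ge0// lerDl//.
Qed.

Lemma ip_small_family g : (forall i, sqi L3 (g i)) -> forall d, 0 < d ->
  exists2 e, 0 < e & forall i h, sqi L3 h -> N h < e -> `|ip L3 (g i) h| <= d.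
Proof.
move=> sg d d0; pose E i := cid2 (ip_small (sg i) d0).
pose m := Order.min (sval (E 0)) (Order.min (sval (E 1)) (sval (E 2%:R))).
exists m => [|i h sh hm].
  by rewrite !lt_min; case: (E 0) => /= ? -> _; case: (E 1) => /= ? -> _;
    case: (E 2%:R) => /= ? ->.
have mi : m <= sval (E i).
  have {hm} : i \in [:: 0; 1; 2%:R] by case: i => -[|[|[|]]].
  by rewrite !inE => /or3P[] /eqP ->; rewrite !ge_min lexx ?orbT.
by case: (E i) mi => /= e e0 he mi; apply: he => //; exact: lt_le_trans mi.
Qed.

(** By density the equation may be tested with elements of $H^1_0$. *)
Lemma form_solution_eq0 mu f g f' g' : sqi L3 f -> (forall i, sqi L3 (g i)) ->
  weak_solution mu f g -> h10 f' g' -> form mu f g f' g' = 0.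
Proof.
move=> sf sg sol [sf' sg' apx].
have D0 : 0 < `|mu| + 3 by rewrite ltr_wpDl.
apply/eqP; rewrite -normr_le0; apply/ler_addgt0Pr => d d0; rewrite add0r.
have d'0 : 0 < d / (`|mu| + 3) by rewrite divr_gt0.
have [e e0 he] := ip_small sf d'0.
have [e1 e10 he1] := ip_small_family sg d'0.
pose m := Order.min e e1.
have m0 : 0 < m by rewrite lt_min e0 e10.
have [phi [tphi hf hg]] := apx m m0.
have me : m <= e by rewrite ge_min lexx.
have me1 : m <= e1 by rewrite ge_min lexx orbT.
have sphi := rtest_sqi tphi.
have sd i := rtest_sqi (rtest_partial i tphi).
have E : form mu f g f' g' =
    form mu f g (fun x => f' x - phi x) (fun i x => g' i x - rpartial i phi x).
  by rewrite formBr// (sol phi tphi) subr0.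
rewrite E /form.
have s1 := sqiB sf' sphi; have s2 i := sqiB (sg' i) (sd i).
have H0 := he _ s1 (lt_le_trans hf me).
have H4 : `|mu * ip L3 f (fun x => f' x - phi x)| <= `|mu| * (d / (`|mu| + 3)).
  by rewrite normrM ler_wpM2l.
have dE : `|mu| * (d / (`|mu| + 3)) + 3 * (d / (`|mu| + 3)) = d.
  by rewrite -mulrDl mulrC divfK// gt_eqF.
apply: (le_trans (ler_normB _ _)).
rewrite -[leRHS]dE [leRHS]addrC; apply: lerD => //.
apply: (le_trans (ler_norm_sum _ _ _)).
have H i := he1 i _ (s2 i) (lt_le_trans (hg i) me1).
apply: (le_trans (ler_sum _ (fun i _ => H i))).
by rewrite sumr_const card_ord mulr_natl.
Qed.

Section iterates.
Variable t : R.
Hypothesis t0 : 0 < t.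

Definition trg g : 'I_3 -> space R -> R := fun i => tr t (g i).
Definition dif f : space R -> R := fun x => f x - tr t f x.
Definition difg g : 'I_3 -> space R -> R := fun i => dif (g i).

Lemma form_tr mu f g f' g' : sqi L3 f -> (forall i, sqi L3 (g i)) ->
  sqi L3 f' -> (forall i, sqi L3 (g' i)) ->
  form mu (tr t f) (trg g) (tr t f') (trg g') = form mu f g f' g'.
Proof.
move=> sf sg sf' sg'; rewrite /form ip_tr//; congr (_ - _).
by apply: eq_bigr => i _; rewrite /trg ip_tr.
Qed.

(** The reason why everything works: the layer is mapped into itself by the
    translations towards positive $x_1$. *)
Lemma layer_translate x : Om x -> Om (x + (t, 0, 0)).
Proof.
move=> [h1 h2 h3]; split.
- by rewrite -[(x + _).1.1]/(x.1.1 + t) -[(x + _).2]/(x.2 + 0) addr0 (lt_trans h1)// ltrDl.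
- by rewrite -[(x + _).1.2]/(x.1.2 + 0) -[(x + _).2]/(x.2 + 0) !addr0.
- by rewrite -[(x + _).2]/(x.2 + 0) addr0.
Qed.

Lemma h10_tr f g : h10 f g -> h10 (tr t f) (trg g).
Proof.
move=> [sf sg apx]; split; first exact: sqi_tr; first by move=> i; exact: sqi_tr.
move=> e e0; have [phi [tphi hf hg]] := apx e e0.
have sphi := rtest_sqi tphi.
have sd i := rtest_sqi (rtest_partial i tphi).
exists (tr t phi); split.
- exact: rtest_tr tphi layer_translate.
- by have := ip_tr_sqr t (sqiB sf sphi) => ->.
- move=> i; rewrite (rpartial_tr _ _ tphi).
  by have := ip_tr_sqr t (sqiB (sg i) (sd i)) => ->.
Qed.

Lemma rtestB O phi psi : rtest O phi -> rtest O psi -> rtest O (fun x => phi x - psi x).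
Proof.
move=> [s1 [K1 c1 [p1 O1]]] [s2 [K2 c2 [p2 O2]]]; split.
  by move=> n; exact: cdB.
exists (K1 `|` K2); first exact: compactU.
split=> [x /= h|x [/O1|/O2]//].
have [p0|p0] := eqVneq (phi x) 0; last by left; exact: p1.
by right; apply: p2 => /=; move: h; rewrite p0 sub0r oppr_eq0.
Qed.

Lemma rpartialB O phi psi i : rtest O phi -> rtest O psi ->
  rpartial i (fun x => phi x - psi x) = (fun x => rpartial i phi x - rpartial i psi x).
Proof.
move=> t1 t2; apply/funext => x; apply: rpartialE; apply: is_deriveB.
- exact: cd_is_derive (rtest_cd 1 t1).
- exact: cd_is_derive (rtest_cd 1 t2).
Qed.

Lemma h10B f g f' g' : h10 f g -> h10 f' g' ->
  h10 (fun x => f x - f' x) (fun i x => g i x - g' i x).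
Proof.
move=> [sf sg apx] [sf' sg' apx']; split; first exact: sqiB.
  by move=> i; exact: sqiB.
move=> e e0; have e4 : 0 < e / 4 by rewrite divr_gt0.
have [phi [tphi hf hg]] := apx _ e4; have [psi [tpsi hf' hg']] := apx' _ e4.
have s1 := rtest_sqi tphi; have s2 := rtest_sqi tpsi.
have sd1 i := rtest_sqi (rtest_partial i tphi).
have sd2 i := rtest_sqi (rtest_partial i tpsi).
exists (fun x => phi x - psi x); split; first exact: rtestB.
  rewrite (_ : (fun x => _) = (fun x => (f x - phi x) - (f' x - psi x))); last first.
    by apply/funext => x; ring.
  exact: arith_quarter (ipB_le (sqiB sf s1) (sqiB sf' s2)) hf hf'.
move=> i; rewrite (rpartialB i tphi tpsi).
rewrite (_ : (fun x => _) = (fun x => (g i x - rpartial i phi x) - (g' i x - rpartial i psi x))).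
  exact: arith_quarter (ipB_le (sqiB (sg i) (sd1 i)) (sqiB (sg' i) (sd2 i))) (hg i) (hg' i).
apply/funext => x.
by move: (rpartial i phi x) (rpartial i psi x) => p q; ring.
Qed.

Lemma h10_dif f g : h10 f g -> h10 (dif f) (difg g).
Proof. by move=> hf; exact: (h10B hf (h10_tr hf)). Qed.

(** The estimate of [ip_tr_sub_le] passes from test functions to their limits, here
    with a factor lost. *)
Lemma h10_dif_le f g : h10 f g -> N (dif f) <= t ^+ 2 * N (g 0) *+ 4.
Proof.
move=> [sf sg apx]; apply/ler_addgt0Pr => d d0.
pose e := d / (8 + t ^+ 2 *+ 4).
have t2 : 0 <= t ^+ 2 by exact: sqr_ge0.
have D0 : 0 < 8 + t ^+ 2 *+ 4 by lra.
have e0 : 0 < e by rewrite divr_gt0.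
have [phi [tphi hf hg]] := apx e e0.
have s1 := rtest_sqi tphi; have sd := rtest_sqi (rtest_partial 0 tphi).
have H1 := ip_tr_sub_le t0 tphi.
have sr := sqiB sf s1.
have E : dif f = (fun x => (phi x - tr t phi x) + ((f x - phi x) - tr t (fun x => f x - phi x) x)).
  by apply/funext => x; rewrite /dif /tr; ring.
have H2 := ipD_le (sqiB s1 (sqi_tr t s1)) (sqiB sr (sqi_tr t sr)).
have H3 := ipB_le sr (sqi_tr t sr); rewrite ip_tr_sqr// in H3.
have H4 : N (rpartial 0 phi) <= N (g 0) *+ 2 + e *+ 2.
  rewrite (_ : rpartial 0 phi = (fun x => g 0 x - (g 0 x - rpartial 0 phi x))); last first.
    by apply/funext => x; rewrite opprB addrCA subrr addr0.
  apply: (le_trans (ipB_le (sg 0) (sqiB (sg 0) sd))).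
  by have := hg 0; lra.
have H5 : t ^+ 2 * N (rpartial 0 phi) <= t ^+ 2 * (N (g 0) *+ 2 + e *+ 2).
  by rewrite ler_wpM2l.
have dE : e * 8 + e * (t ^+ 2 *+ 4) = d by rewrite -mulrDr /e divfK// gt_eqF.
rewrite E; apply: (le_trans H2); lra.
Qed.

(** Each pair is orthogonal, for the bilinear form, to all the translates of the
    other: this is the property of a solution that its differences inherit. *)
Definition orth mu f g f' g' := forall k,
  form mu f g (iter k (tr t) f') (iter k trg g') = 0 /\
  form mu (iter k (tr t) f) (iter k trg g) f' g' = 0.

Lemma orthC mu f g f' g' : orth mu f g f' g' -> orth mu f' g' f g.
Proof. by move=> o k; have [p1 p2] := o k; split; rewrite formC. Qed.

Lemma iter_sqi k f : sqi L3 f -> sqi L3 (iter k (tr t) f).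
Proof. by move=> sf; elim: k => //= k; exact: sqi_tr. Qed.

Lemma iter_sqig k g i : (forall i, sqi L3 (g i)) -> sqi L3 (iter k trg g i).
Proof. by move=> sg; elim: k i => //= k IH i; exact: sqi_tr. Qed.

Lemma iter_tr_dif k f : iter k (tr t) (dif f) =
  (fun x => iter k (tr t) f x - iter k.+1 (tr t) f x).
Proof. by elim: k => //= k ->. Qed.

Lemma iter_trg_difg k g : iter k trg (difg g) =
  (fun i x => iter k trg g i x - iter k.+1 trg g i x).
Proof. by elim: k => //= k ->. Qed.

(** Where the translation falls on [f], it is removed from both sides at once by the
    invariance of the form. *)
Lemma orth_dif mu f g f' g' : sqi L3 f -> (forall i, sqi L3 (g i)) ->
  sqi L3 f' -> (forall i, sqi L3 (g' i)) ->
  orth mu f g f' g' -> orth mu (dif f) (difg g) f' g'.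
Proof.
move=> sf sg sf' sg' o k; split.
  rewrite formBl//; [|exact: sqi_tr|by move=> i; exact: sqi_tr|exact: iter_sqi|
    by move=> i; exact: iter_sqig].
  have [-> _] := o k; rewrite sub0r; apply/eqP; rewrite oppr_eq0; apply/eqP.
  case: k => [|k]; first by have [] := o 1%N.
  rewrite /= -/(trg _) form_tr//; [by have [] := o k|exact: iter_sqi|].
  by move=> i; exact: iter_sqig.
rewrite iter_tr_dif iter_trg_difg formBl//; try exact: iter_sqi;
  try by move=> i; exact: iter_sqig.
by have [_ ->] := o k; have [_ ->] := o k.+1; rewrite subr0.
Qed.

Section solution.
Variables (mu : R) (f : space R -> R) (g : 'I_3 -> space R -> R).
Hypotheses (hf : h10 f g) (sol : weak_solution mu f g).
Hypothesis tmu : t ^+ 2 * `|mu| <= 1 / 16.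

Local Notation F n := (iter n dif f).
Local Notation G n := (iter n difg g).

Lemma h10_iter n : h10 (F n) (G n).
Proof. by elim: n => //= n; exact: h10_dif. Qed.

(** For a solution [f], a translate of [f] belongs to $H^1_0$ and so may be used to
    test the equation of [f]. *)
Lemma orth_iter n m : orth mu (F n) (G n) (F m) (G m).
Proof.
have sqF k : sqi L3 (F k) by case: (h10_iter k).
have sqG k i : sqi L3 (G k i) by case: (h10_iter k).
have o0 : orth mu f g f g.
  move=> k; have hk : h10 (iter k (tr t) f) (iter k trg g).
    by elim: k => //= k; exact: h10_tr.
  have [sf sg _] := hf.
  by split; [|rewrite formC]; exact: form_solution_eq0.
have om k : orth mu f g (F k) (G k).
  elim: k => //= k IH; apply: orthC; apply: orth_dif => //; last exact: orthC.
  - exact: (sqF 0%N).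
  - exact: (sqG 0%N).
by elim: n => //= n IH; exact: orth_dif.
Qed.

(** Since the form vanishes on the differences, the squared norm of their gradient
    is [mu] times their squared norm. By [h10_dif_le] one more difference then
    reduces the norm when the step is small. *)
Lemma iter_dif_le n : N (F n.+1) <= N (F n) / 4.
Proof.
have := h10_dif_le (h10_iter n) => /= h; apply: (le_trans h).
have [+ _] := orth_iter n n 0%N; rewrite /= /form !big_ord_recl big_ord0 addr0 => /eqP.
rewrite subr_eq0 => /eqP Q.
have p0 := ip_ge0 L3 (G n (lift ord0 ord0)).
have p1 := ip_ge0 L3 (G n (lift ord0 (lift ord0 ord0))).
have q0 := ip_ge0 L3 (F n).
have H : N (G n 0) <= `|mu| * N (F n).
  apply: (@le_trans _ _ (mu * N (F n))); last by rewrite ler_wpM2r// ler_norm.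
  rewrite -Q lerDl addr_ge0//.
have H1 : t ^+ 2 * N (G n 0) <= t ^+ 2 * (`|mu| * N (F n)).
  by rewrite ler_wpM2l// sqr_ge0.
have H2 : t ^+ 2 * `|mu| * N (F n) <= 1 / 16 * N (F n) by rewrite ler_wpM2r.
by rewrite mulrA in H1; exact: arith_sixteenth H1 H2.
Qed.

Lemma iter_dif_le_expr n : N (F n) <= N f / 4 ^+ n.
Proof.
elim: n => [|n IH]; first by rewrite expr0 divr1.
apply: (le_trans (iter_dif_le n)).
by rewrite exprSr invfM mulrA ler_wpM2r.
Qed.

Hypothesis f0 : forall x, ~ Om x -> f x = 0.

Let S (m : nat) : set (mspace R) := [set x | x.1.1 < - `|k1| + m%:R * t].

Let mS m : measurable (S m).
Proof.
apply: open_measurable_space.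
rewrite (_ : S m = [set x : space R |
    0 < (-1) * x.1.1 + 0 * x.1.2 + 0 * x.2 + (- `|k1| + m%:R * t)]).
  exact: open_affine.
by apply/seteqP; split=> x; rewrite /S/= => h; lra.
Qed.

(** If [f] vanishes on [S m], its iterated differences coincide with it on [S m.+1],
    yet they tend to zero. *)
Lemma slab_eq0 m : N (rst (S m) f) = 0.
Proof.
have sqF k : sqi L3 (F k) by case: (h10_iter k).
have sf : sqi L3 f := sqF 0%N.
elim: m => [|m IH].
  rewrite (_ : rst (S 0) f = (fun x => 0 * f x)); first by rewrite ipZZ// expr0n mul0r.
  apply/funext => x; rewrite mul0r; have [Sx|Sx] := pselect (S 0%N x); last exact: rst_out.
  rewrite rst_in// f0// => -[h1 h2 /andP[h3 h4]]; move: Sx; rewrite /S/= mul0r addr0.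
  apply/negP; rewrite -leNgt; apply: le_trans (ltW h1).
  rewrite lerNl; apply: (@le_trans _ _ (`|k1| * x.2)).
    by rewrite -mulNr ler_wpM2r ?(ltW h3)// -normrN ler_norm.
  by rewrite ler_piMr// ltW.
have le0 (a : R) : a <= 0 -> 0 <= a -> a = 0 by move=> *; apply/eqP; rewrite eq_le; apply/andP.
have mono (u : space R -> R) : sqi L3 u -> N (rst (S m) u) <= N (rst (S m.+1) u).
  move=> su; apply: le_ip; [exact: sqi_rst|exact: sqi_rst|] => x.
  have [Sx|Sx] := pselect (S m x); last by rewrite rst_out// expr0n/= sqr_ge0.
  rewrite !rst_in//; move: Sx; rewrite /S/= => /lt_le_trans; apply.
  by rewrite lerD2l ler_wpM2r ?(ltW t0)// ler_nat.
(* By induction [F n = f] on [S m.+1], since the translate of [S m] is [S m.+1]. *)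
have D n : N (rst (S m.+1) (fun x => F n x - f x)) = 0.
  elim: n => [|n IHn].
    rewrite (_ : rst _ _ = (fun x => 0 * f x)); first by rewrite ipZZ// expr0n mul0r.
    by apply/funext => x; rewrite /rst /= subrr mulr0 mul0r.
  apply: le0; last exact: ip_ge0.
  rewrite (_ : rst _ _ = (fun x => rst (S m.+1) (fun x => F n x - f x) x
      - tr t (rst (S m) (F n)) x)); last first.
    apply/funext => x; rewrite /rst /= /dif /tr !indicE.
    rewrite (_ : (x + (- t, 0, 0) \in S m) = (x \in S m.+1)); first by ring.
    by apply/idP/idP; rewrite !inE /S/= -natr1 mulrDl mul1r addrA ltrBlDr.
  have s1 := sqi_rst (mS m.+1) (sqiB (sqF n) sf).
  have s2 := sqi_rst (mS m) (sqF n).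
  apply: (le_trans (ipB_le s1 (sqi_tr t s2))); rewrite IHn ip_tr_sqr//.
  rewrite mul0rn add0r.
  suff -> : N (rst (S m) (F n)) = 0 by rewrite mul0rn.
  apply/eqP; rewrite eq_le; apply/andP; split; last exact: ip_ge0.
  rewrite (_ : rst _ _ = (fun x => rst (S m) (fun x => F n x - f x) x + rst (S m) f x)).
    have s3 := sqi_rst (mS m) (sqiB (sqF n) sf).
    apply: (le_trans (ipD_le s3 (sqi_rst (mS m) sf))).
    by rewrite IH mul0rn addr0; have := mono _ (sqiB (sqF n) sf); rewrite IHn; lra.
  by apply/funext => x; rewrite /rst; ring.
have B n : N (rst (S m.+1) f) <= (N f *+ 2) / 4 ^+ n.
  rewrite (_ : rst (S m.+1) f =
      (fun x => rst (S m.+1) (F n) x - rst (S m.+1) (fun x => F n x - f x) x)).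
    apply: (le_trans (ipB_le (sqi_rst (mS m.+1) (sqF n)) (sqi_rst (mS m.+1) (sqiB (sqF n) sf)))).
    rewrite D mul0rn addr0 mulrnAl lerMn2r/=.
    apply: le_trans (iter_dif_le_expr n); exact: ip_rst_le.
  by apply/funext => x; rewrite /rst; ring.
apply: le0; last exact: ip_ge0.
apply: (@le_pinv_pow R (N f *+ 2)) => //; first by rewrite mulrn_wge0// ip_ge0.
Qed.

Lemma solution_eq0 : N f = 0.
Proof.
have sf : sqi L3 f by case: hf.
have mT m : measurable (~` S m) by apply: measurableC; exact: mS.
have T0 x : \forall n \near \oo, ~ (~` S n) x.
  near=> n; rewrite /setC/= /S/= => H; apply: H.
  rewrite -ltrBlDl -ltr_pdivrMr//.
  near: n; exact: nbhs_infty_gtr.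
have half n : N f <= N (rst (~` S n) f) *+ 2.
  rewrite {1 2}(_ : f = (fun x => rst (S n) f x + rst (~` S n) f x)).
    apply: (le_trans (ipD_le (sqi_rst (mS n) sf) (sqi_rst (mT n) sf))).
    by rewrite slab_eq0 mul0rn add0r.
  apply/funext => x; have [Sx|Sx] := pselect (S n x).
    by rewrite (rst_in f Sx) rst_out ?addr0//; apply.
  by rewrite (rst_out f Sx) rst_in ?add0r.
apply/eqP; rewrite eq_le ip_ge0 andbT leNgt; apply/negP => f_gt0.
have /cvgr0Pnorm_lt/(_ (N f / 2)) := ip_rst_cvg0 mT sf T0.
move=> /(_ (divr_gt0 f_gt0 (ltr0Sn _ _)))[n _ /(_ n (leqnn n))] /=.
rewrite ger0_norm ?ip_ge0// ltr_pdivlMr// => H.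
by have := half n; rewrite leNgt -mulr_natr H.
Unshelve. all: by end_near. Qed.

End solution.
End iterates.
End translation_argument.

(** * Complex solutions *)

Lemma step_le (R : realType) (m : R) : (1 / (4 * (1 + `|m|))) ^+ 2 * `|m| <= 1 / 16.
Proof.
have : 0 <= `|m| by []; move: `|m| => {}m m0.
have d0 : 0 < 4 * (1 + m) by lra.
rewrite expr_div_n expr1n mulrAC mul1r ler_pdivrMr ?exprn_gt0//.
by nra.
Qed.

Lemma im_part_eq0 (R : realType) (s x y p q : R) :
  s - (x - y * q) = 0 -> s - (x + y * p) = 0 -> y * (p + q) = 0.
Proof. by move=> h1 h2; lra. Qed.

Section complex_parts.
Variables (R : realType) (k1 k2 : R).
Local Notation L3 := (leb3 : {measure set (mspace R) -> \bar R}).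
Local Notation N f := (ip L3 f f).
Local Notation Om := (layer k1 k2 : set (mspace R)).
Local Notation area := (planes_area k1 k2 : {measure set (mspace R) -> \bar R}).
Implicit Types (f u : space R -> R[i]) (phi psi : space R -> R).

Let mOm : measurable Om. Proof. exact: measurable_layer. Qed.

Lemma cvge0_near_lt (h : (\bar R)^nat) (e : R) : 0 < e ->
  h n @[n --> \oo] --> 0%E -> \forall n \near \oo, (h n < e%:E)%E.
Proof.
move=> e0 /fine_cvgP[fh ch]; have /cvgr0Pnorm_lt/(_ e e0) c := ch.
near=> n; have fn : h n \is a fin_num by near: n.
rewrite -(fineK fn) lte_fin; apply: le_lt_trans (ler_norm _) _.
by near: n.
Unshelve. all: by end_near. Qed.

Section part.
Variable pr : R[i] -> R.
(** The real and imaginary parts of the data are treated alike. *)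
Hypothesis prP : pr = @complex.Re R \/ pr = @complex.Im R.

Local Notation pt f := (fun x : space R => pr (f x)).

Let prB z z' : pr (z - z') = pr z - pr z'.
Proof. by case: prP => ->; case: z => ? ?; case: z' => ? ?. Qed.

Let pr_sqmod z : pr z ^+ 2 <= sqmod z.
Proof. by rewrite /sqmod; case: prP => ->; rewrite ?lerDl ?lerDr sqr_ge0. Qed.

Let pt_partial i f : pt (partial i f) = rpartial i (pt f).
Proof. by case: prP => ->; apply/funext. Qed.

Let pt_measurable (mu : {measure set (mspace R) -> \bar R}) (D : set (mspace R)) f :
  L2 mu D f -> measurable_fun D (pt f : mspace R -> R).
Proof. by move=> [m1 m2 _]; case: prP => ->. Qed.

Let rtest_pt O f : rtest O (re f) -> rtest O (im f) -> rtest O (pt f).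
Proof. by case: prP => ->. Qed.

Lemma measurable_sqmod_sub (D : set (mspace R)) f g : measurable D ->
  measurable_fun D (re f : mspace R -> R) -> measurable_fun D (im f : mspace R -> R) ->
  measurable_fun D (re g : mspace R -> R) -> measurable_fun D (im g : mspace R -> R) ->
  measurable_fun D ((fun x => (sqmod (f x - g x))%:E) : mspace R -> \bar R).
Proof.
move=> mD f1 f2 g1 g2; apply/measurable_EFinP; rewrite /sqmod.
have m1 : measurable_fun D ((fun x => re f x - re g x) : mspace R -> R) by exact: measurable_funB.
have m2 : measurable_fun D ((fun x => im f x - im g x) : mspace R -> R) by exact: measurable_funB.
have := measurable_funD (measurable_funX 2 m1) (measurable_funX 2 m2).
apply: eq_measurable_fun => x _; rewrite /re /im /=.
by case: (f x) => ? ?; case: (g x).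
Qed.

Lemma sqi_part f : L2 leb3 Om f -> sqi L3 (rst Om (pt f)).
Proof.
move=> l2; have [m1 m2 fin] := l2; have mpt := pt_measurable l2.
have rE : rst Om (pt f) = (pt f) \_ Om.
  by apply/funext => x; rewrite patchE /rst indicE; case: (_ \in _); rewrite ?mul1r ?mul0r.
split; first by rewrite rE; exact/(measurable_restrictT _ mOm).
apply: le_lt_trans fin.
rewrite /sq_dist [leRHS]integral_mkcond.
have msq : measurable_fun Om ((fun x => (sqmod (f x - 0))%:E) : mspace R -> \bar R).
  by apply: measurable_sqmod_sub => //; exact: measurable_cst.
apply: ge0_le_integral => //.
- by move=> x _; rewrite lee_fin sqr_ge0.
- apply/measurable_EFinP; apply: measurable_funX; rewrite rE.
  exact/(measurable_restrictT _ mOm).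
- exact/(measurable_restrictT _ mOm).
- move=> x _; rewrite rE !patchE; case: ifP => _; last by rewrite expr0n.
  by rewrite lee_fin subr0.
Qed.

Lemma part_sq_dist f (psi : space R -> R[i]) (e : R) : L2 leb3 Om f ->
  rtest setT (re psi) -> rtest setT (im psi) -> (sq_dist leb3 Om psi f < e%:E)%E ->
  N (fun x => rst Om (pt f) x - rst Om (pt psi) x) < e.
Proof.
move=> l2 tre tim; have [m1 m2 _] := l2; rewrite -lte_fin; apply: le_lt_trans.
have spsi : sqi L3 (pt psi) by exact: rtest_sqi (rtest_pt tre tim).
have s1 : sqi L3 (fun x => rst Om (pt f) x - rst Om (pt psi) x).
  by apply: sqiB; [exact: sqi_part|exact: sqi_rst].
rewrite -(ip_sqr s1) /sq_dist [leRHS]integral_mkcond.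
have mt (g : space R -> R) : rtest setT g -> measurable_fun Om (g : mspace R -> R).
  move=> tg; apply: measurable_funTS; exact: (rtest_sqi tg).1.
have msq : measurable_fun Om ((fun x => (sqmod (psi x - f x))%:E) : mspace R -> \bar R).
  by apply: measurable_sqmod_sub => //; exact: mt.
apply: ge0_le_integral => //.
- by move=> x _; rewrite lee_fin sqr_ge0.
- by apply/measurable_EFinP; apply: measurable_funX; exact: s1.1.
- exact/(measurable_restrictT _ mOm).
- move=> x _; rewrite patchE; case: ifPn => [|/negP] h.
    have Ox : Om x by rewrite inE in h.
    by rewrite !rst_in// lee_fin -opprB sqrrN -prB.
  have nOx : ~ Om x by move=> Ox; apply: h; rewrite inE.
  by rewrite !rst_out// subr0 expr0n.
Qed.

Lemma part_sq_dist_boundary (psi : space R -> R[i]) (e : R) :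
  rtest setT (re psi) -> rtest setT (im psi) ->
  (sq_dist area (boundary (layer k1 k2)) psi (fun=> 0%R) < e%:E)%E ->
  (\int[area]_(x in boundary (layer k1 k2)) (pr (psi x) ^+ 2)%:E < e%:E)%E.
Proof.
move=> tre tim; apply: le_lt_trans; rewrite /sq_dist.
have mb := measurable_boundary (layer k1 k2).
have mt (g : space R -> R) : rtest setT g ->
    measurable_fun (boundary (layer k1 k2) : set (mspace R)) (g : mspace R -> R).
  move=> tg; apply: measurable_funTS; exact: (rtest_sqi tg).1.
apply: ge0_le_integral => //.
- by move=> x _; rewrite lee_fin sqr_ge0.
- apply/measurable_EFinP; apply: measurable_funX; apply: mt; exact: rtest_pt tre tim.
- apply: measurable_sqmod_sub => //; try exact: measurable_cst.
    exact: mt.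
  exact: mt.
- by move=> x _; rewrite lee_fin subr0.
Qed.

Lemma zero_trace_h10 u w (phi : nat -> space R -> R[i]) : L2 leb3 Om u ->
  (forall i, L2 leb3 Om (w i)) -> (forall n, test_function setT (phi n)) ->
  sq_dist leb3 Om (phi n) u @[n --> \oo] --> 0%E ->
  (forall i, sq_dist leb3 Om (partial i (phi n)) (w i) @[n --> \oo] --> 0%E) ->
  sq_dist area (boundary (layer k1 k2)) (phi n) (fun=> 0) @[n --> \oo] --> 0%E ->
  h10 k1 k2 (rst Om (pt u)) (fun i => rst Om (pt (w i))).
Proof.
move=> l2u l2w tphi cu cw cb.
have su := sqi_part l2u; have sw i := sqi_part (l2w i).
have tre n := rtest_re (tphi n); have tim n := rtest_im (tphi n).
have ztr : approximable_zero_trace k1 k2 (rst Om (pt u)) (fun i => rst Om (pt (w i))).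
  move=> e e0.
  have nw : \forall n \near \oo, forall i,
      (sq_dist leb3 Om (partial i (phi n)) (w i) < e%:E)%E.
    by apply: filter_forall => i; exact: cvge0_near_lt.
  have [n _ /(_ n (leqnn n)) [[hu hw] hb]] :=
    filterI (filterI (cvge0_near_lt e0 cu) nw) (cvge0_near_lt e0 cb).
  exists (pt (phi n)); split.
  - exact: rtest_pt.
  - exact: part_sq_dist.
  - move=> i; rewrite -pt_partial; apply: part_sq_dist (hw i) => //.
      exact: rtest_partial i (tre n).
    exact: rtest_partial i (tim n).
  - exact: part_sq_dist_boundary.
have apx := approximable_layer su sw (fun x => @rst_out _ Om _ x)
  (fun i x => @rst_out _ Om _ x) ztr.
have rst_id psi : rtest Om psi -> rst Om psi = psi.
  move=> tpsi; apply/funext => x; have [Ox|nOx] := pselect (Om x); first by rewrite rst_in.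
  by rewrite rst_out// (rtest_notin tpsi nOx).
split=> // e e0; have [psi [tpsi hpsi hd]] := apx e e0; exists psi; split=> //.
  by have := hpsi; rewrite (rst_id _ tpsi).
by move=> i; have := hd i; rewrite (rst_id _ (rtest_partial i tpsi)).
Qed.

End part.

Local Notation rpart u := (rst Om (re u)).
Local Notation ipart u := (rst Om (im u)).
Local Notation cpx psi := (fun x => psi x +i* 0)%C.

Lemma cintegral_mul f (psi : space R -> R) :
  cintegral Om (fun x => f x * cpx psi x) =
  (ip L3 (rpart f) psi +i* ip L3 (ipart f) psi)%C.
Proof.
have E (g h : space R -> R) : (forall x, h x = g x * psi x) ->
    Rintegral leb3 Om h = ip L3 (rst Om g) psi.
  move=> gh; rewrite /ip Rintegral_mkcond; apply: eq_Rintegral => x _.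
  by rewrite patchE /rst indicE; case: (_ \in _); rewrite ?mul1r// !mul0r.
rewrite /cintegral; congr (_ +i* _)%C; apply: E => x; rewrite /re /im;
  by case: (f x) => p q /=; rewrite mulr0 ?subr0 ?add0r.
Qed.

Lemma partial_cpx i (psi : space R -> R) :
  partial i (cpx psi) = cpx (rpartial i psi).
Proof.
apply/funext => x; rewrite /partial; congr (_ +i* _)%C.
by apply: rpartialE; exact: is_derive_cst.
Qed.

Lemma laplacian_cpx psi : laplacian (cpx psi) =
  cpx (fun x => \sum_(i < 3) rpartial i (rpartial i psi) x).
Proof.
apply/funext => x; rewrite /laplacian.
rewrite -[RHS]/(\sum_(i < 3) rpartial i (rpartial i psi) x)%:C%C rmorph_sum.
by apply: eq_bigr => i _; rewrite (partial_cpx i psi) (partial_cpx i (rpartial i psi)).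
Qed.

Lemma ip_sum3 (f : space R -> R) (g : 'I_3 -> space R -> R) : sqi L3 f -> (forall i, sqi L3 (g i)) ->
  ip L3 f (fun x => \sum_(i < 3) g i x) = \sum_(i < 3) ip L3 f (g i).
Proof.
move=> sf sg; rewrite ipC (_ : (fun x => _) = (fun x => g ord0 x + (g (lift ord0 ord0) x +
    g (lift ord0 (lift ord0 ord0)) x))); last first.
  by apply/funext => x; rewrite !big_ord_recl big_ord0 addr0.
rewrite ipDl//; last exact: sqiD.
have C h : ip L3 f h = ip L3 h f by exact: ipC.
by rewrite ipDl// !big_ord_recl big_ord0 addr0 !C.
Qed.

Lemma weak_partial_parts u w i phi : weak_partial Om i u w -> rtest Om phi ->
  ip L3 (rpart u) (rpartial i phi) = - ip L3 (rpart w) phi /\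
  ip L3 (ipart u) (rpartial i phi) = - ip L3 (ipart w) phi.
Proof.
move=> wp tphi; have := wp _ (rtest_test_function tphi).
by rewrite (partial_cpx i phi) !cintegral_mul => -[].
Qed.

(** The Laplacian is moved to the gradient of [u] by using the weak derivatives with
    the partial derivatives of the test function. *)
Lemma helmholtz_parts (l : R[i]) u w phi : L2 leb3 Om u ->
  (forall i, weak_partial Om i u (w i)) -> helmholtz Om l u -> rtest Om phi ->
  \sum_(i < 3) ip L3 (rpart (w i)) (rpartial i phi) =
    complex.Re l * ip L3 (rpart u) phi - complex.Im l * ip L3 (ipart u) phi /\
  \sum_(i < 3) ip L3 (ipart (w i)) (rpartial i phi) =
    complex.Re l * ip L3 (ipart u) phi + complex.Im l * ip L3 (rpart u) phi.
Proof.
move=> l2 wp hl tphi.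
have sp : sqi L3 (rpart u) by apply: (sqi_part (or_introl erefl) l2).
have sq : sqi L3 (ipart u) by apply: (sqi_part (or_intror erefl) l2).
have s2 i : sqi L3 (rpartial i (rpartial i phi)).
  exact: rtest_sqi (rtest_partial i (rtest_partial i tphi)).
have E i := weak_partial_parts (wp i) (rtest_partial i tphi).
have := hl _ (rtest_test_function tphi).
rewrite laplacian_cpx !cintegral_mul !ip_sum3//.
have S1 : \sum_(i < 3) ip L3 (rpart u) (rpartial i (rpartial i phi)) =
    - \sum_(i < 3) ip L3 (rpart (w i)) (rpartial i phi).
  by rewrite -sumrN; apply: eq_bigr => i _; exact: (E i).1.
have S2 : \sum_(i < 3) ip L3 (ipart u) (rpartial i (rpartial i phi)) =
    - \sum_(i < 3) ip L3 (ipart (w i)) (rpartial i phi).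
  by rewrite -sumrN; apply: eq_bigr => i _; exact: (E i).2.
have F (x y z : R) : x = - y -> - x = z -> y = z by move=> -> <-; rewrite opprK.
by case: l {hl} => l1 l2' /= -[h1 h2]; split; [exact: F S1 h1|exact: F S2 h2].
Qed.

(** The equations of the real and imaginary parts are coupled by the imaginary part
    of [l] alone. Testing each with the other function gives
    $\Im l (\|\Re u\|^2 + \|\Im u\|^2) = 0$, so either both vanish or both are
    real solutions. *)
Lemma solution_parts_eq0 u (l : R[i]) : H1 Om u -> helmholtz Om l u ->
  has_trace Om area u (fun=> 0) -> N (rpart u) = 0 /\ N (ipart u) = 0.
Proof.
move=> [l2u _] hl [_ [w [wg [phi [tphi cu cw cb]]]]].
have l2w i : L2 leb3 Om (w i) by case: (wg i).
have wp i : weak_partial Om i u (w i) by case: (wg i).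
have H psi := helmholtz_parts l2u wp hl (phi := psi).
have ha : h10 k1 k2 (rpart u) (fun i => rpart (w i)).
  exact: (zero_trace_h10 (or_introl erefl) l2u l2w tphi cu cw cb).
have hb : h10 k1 k2 (ipart u) (fun i => ipart (w i)).
  exact: (zero_trace_h10 (or_intror erefl) l2u l2w tphi cu cw cb).
have [sa swa _] := ha; have [sb swb _] := hb.
have [l0|l0] := eqVneq (complex.Im l) 0.
  pose t : R := 1 / (4 * (1 + `|complex.Re l|)).
  have t0 : 0 < t by rewrite divr_gt0// mulr_gt0// ltr_pwDl.
  have tl : t ^+ 2 * `|complex.Re l| <= 1 / 16 by exact: step_le.
  have nO (g : space R -> R) x : ~ layer k1 k2 x -> rst Om g x = 0 by exact: rst_out.
  have wa : weak_solution k1 k2 (complex.Re l) (rpart u) (fun i => rpart (w i)).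
    by move=> psi tpsi; rewrite /form (H psi tpsi).1 l0 mul0r subr0 subrr.
  have wb : weak_solution k1 k2 (complex.Re l) (ipart u) (fun i => ipart (w i)).
    by move=> psi tpsi; rewrite /form (H psi tpsi).2 l0 mul0r addr0 subrr.
  by split; [exact: (solution_eq0 t0 ha wa tl (nO _))|
    exact: (solution_eq0 t0 hb wb tl (nO _))].
pose l1 := complex.Re l; pose l2 := complex.Im l.
have s1 : sqi L3 (fun x => l1 * rpart u x - l2 * ipart u x).
  by apply: sqiB; exact: sqiZ.
have s2 : sqi L3 (fun x => l1 * ipart u x + l2 * rpart u x).
  by apply: sqiD; exact: sqiZ.
have sol1 : weak_solution k1 k2 1 (fun x => l1 * rpart u x - l2 * ipart u x)
    (fun i => rpart (w i)).
  move=> psi tpsi; have sp := rtest_sqi tpsi; have [h1 _] := H psi tpsi.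
  by rewrite /form h1 mul1r ipBl ?ipZl ?subrr//; exact: sqiZ.
have sol2 : weak_solution k1 k2 1 (fun x => l1 * ipart u x + l2 * rpart u x)
    (fun i => ipart (w i)).
  move=> psi tpsi; have sp := rtest_sqi tpsi; have [_ h2] := H psi tpsi.
  by rewrite /form h2 mul1r ipDl ?ipZl ?subrr//; exact: sqiZ.
have e1 := form_solution_eq0 s1 swa sol1 hb.
have e2 := form_solution_eq0 s2 swb sol2 ha.
have e3 : \sum_(i < 3) ip L3 (rpart (w i)) (ipart (w i)) =
    \sum_(i < 3) ip L3 (ipart (w i)) (rpart (w i)).
  by apply: eq_bigr => i _; rewrite ipC.
move: e1 e2; rewrite /form e3 !mul1r ipBl ?ipDl ?ipZl//; try exact: sqiZ.
have e4 : ip L3 (ipart u) (rpart u) = ip L3 (rpart u) (ipart u) by exact: ipC.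
rewrite e4 => e1 e2.
have Z : l2 * (N (rpart u) + N (ipart u)) = 0 by exact: (im_part_eq0 e1 e2).
move/eqP : Z; rewrite mulf_eq0 (negbTE l0)/= paddr_eq0 ?ip_ge0//.
by move=> /andP[/eqP -> /eqP ->].
Qed.

End complex_parts.

Theorem proposition8p1 (R : realType) (kappa1 kappa2 : R)
    (u : R * R * R -> R[i]) (lambda : R[i])
    (hu : H1 (layer kappa1 kappa2) u)
    (heq : helmholtz (layer kappa1 kappa2) lambda u)
    (hbc : has_trace (layer kappa1 kappa2) (planes_area kappa1 kappa2)
             u (fun=> 0)) :
  {ae @leb3 R, forall x, layer kappa1 kappa2 x -> u x = 0}.
Proof.
have [Na Nb] := solution_parts_eq0 hu heq hbc; have [l2u _] := hu.
have ae1 := ip_ae0 (sqi_part (or_introl erefl) l2u) Na.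
have ae2 := ip_ae0 (sqi_part (or_intror erefl) l2u) Nb.
apply: filterS2 ae1 ae2 => x h1 h2 Ox; move: h1 h2.
by rewrite !rst_in// /re /im; case: (u x) => p q /= -> ->.
Qed.
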